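(* Let $(\mathbb V,\operatorname{dist})$ be a Polish and perfect metric space. Then the set $$\mathcal{DS}^{SH}(\mathbb V)=\{f\in\mathcal{DS}(\mathbb V): f\text{ is conjugate to the Special Homeomorphism}\}$$ is a dense $G_\delta$ subset of $(\mathcal{DS}(\mathbb V),\mathrm{D_H})$.
   Context: A topological space is Polish if it is separable and admits a compatible complete metric; it is perfect if it has no isolated points. A Cantor space is a (nonempty) compact, perfect, totally disconnected metric space. For a metric space $(N,\operatorname{dist})$, $\mathcal K(N)$ is the set of nonempty compact subsets of $N$, with the Hausdorff distance $\operatorname{dist}_H(X,Y)=\inf\{\epsilon>0: X\subseteq B_\epsilon(Y),\ Y\subseteq B_\epsilon(X)\}$, where $B_\epsilon(X)=\bigcup_{x\in X}B_\epsilon(x)$. On $\mathbb V^2=\mathbb V\times\mathbb V$ use the max-metric $\operatorname{dist}_2((a,b),(c,d))=\max\{\operatorname{dist}(a,c),\operatorname{dist}(b,d)\}$, and let $\pi_1,\pi_2:\mathbb V^2\to\mathbb V$ be the coordinate projections. Define $\mathcal{DS}(\mathbb V)=\{f\in\mathcal K(\mathbb V^2):\pi_1(f)=\pi_2(f)\}$, with metric $\mathrm{D_H}$ the Hausdorff distance on $\mathcal K(\mathbb V^2)$ associated to $\operatorname{dist}_2$. For $f\in\mathcal{DS}(\mathbb V)$ put $M(f)=\pi_1(f)=\pi_2(f)$. Functions are identified with their graphs, so a homeomorphism (or continuous surjection) of a nonempty compact set $M\subset\mathbb V$ onto itself is an element $f$ of $\mathcal{DS}(\mathbb V)$ with $M(f)=M$.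 Two homeomorphisms $f:X\to X$ and $g:Y\to Y$ are (topologically) conjugate if there is a homeomorphism $\varphi:X\to Y$ with $g\varphi=\varphi f$. Special Homeomorphism: for a Cantor space $K$, let $H(K)$ be the group of homeomorphisms of $K$ with the $C^0$ (uniform convergence) topology, which is Polish. By a theorem of Kechris and Rosendal (see also Akin, Glasner and Weiss), there is a conjugacy class in $H(K)$ that is a dense $G_\delta$ subset of $H(K)$; by the Baire category theorem it is unique. The Special Homeomorphism is any element of this class (well defined up to topological conjugacy, and independent of $K$, since all Cantor spaces are homeomorphic). Thus ''$f$ is conjugate to the Special Homeomorphism'' means that $f$ is (the graph of) a homeomorphism of a Cantor space $M(f)$ onto itself that is topologically conjugate to such an element. *)

(* Defs.v *)
From HB Require Import structures.
From mathcomp Require Import all_boot all_order all_algebra.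
From mathcomp Require Import all_classical all_reals all_analysis borel_hierarchy.

Set Implicit Arguments.
Unset Strict Implicit.
Unset Printing Implicit Defensive.

Import Order.TTheory GRing.Theory Num.Theory.

Local Open Scope classical_set_scope.
Local Open Scope ring_scope.

Section prod_metric.
Context {R : realType} {V W : metricType R}.

Definition prod_mdist (x y : V * W) : R :=
  Num.max (mdist x.1 y.1) (mdist x.2 y.2).

Let prod_mdist_ge0 x y : 0 <= prod_mdist x y.
Proof. by rewrite /prod_mdist le_max mdist_ge0. Qed.

Let prod_mdist_positivity x y : prod_mdist x y = 0 -> x = y.
Proof.
move=> xy0; have : prod_mdist x y <= 0 by rewrite xy0.
rewrite ge_max => /andP[h1 h2].
have e1 : mdist x.1 y.1 = 0 by apply/eqP; rewrite eq_le h1 mdist_ge0.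
have e2 : mdist x.2 y.2 = 0 by apply/eqP; rewrite eq_le h2 mdist_ge0.
by case: x y e1 e2 {xy0 h1 h2} => [x1 x2] [y1 y2] /= /mdist_positivity-> /mdist_positivity->.
Qed.

Let ballE_prod_mdist x d : ball x d = [set y | prod_mdist x y < d].
Proof.
apply/seteqP; split => y /=; rewrite /ball/= /prod_ball !ballEmdist/=
  /prod_mdist gt_max.
  by case=> -> ->.
by move/andP.
Qed.

HB.instance Definition _ := PseudoMetric_isMetric.Build R (V * W)%type
  prod_mdist_ge0 prod_mdist_positivity ballE_prod_mdist.

End prod_metric.

Section subtype_metric.
Context {R : realType} {V : metricType R} (A : set V).

Definition set_mdist (x y : A) : R := mdist (set_val x) (set_val y).

Let set_mdist_ge0 x y : 0 <= set_mdist x y.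
Proof. exact: mdist_ge0. Qed.

Let set_mdist_positivity x y : set_mdist x y = 0 -> x = y.
Proof. by move=> /mdist_positivity /val_inj. Qed.

Let ballE_set_mdist x d : ball x d = [set y | set_mdist x y < d].
Proof.
by apply/seteqP; split => y; rewrite /ball/= /initial_ball ballEmdist.
Qed.

HB.instance Definition _ := PseudoMetric_isMetric.Build R (set_type A)
  set_mdist_ge0 set_mdist_positivity ballE_set_mdist.

End subtype_metric.

Section hausdorff_distance.
Context {R : realType} (N : metricType R).

(* The nonempty compact subsets of N. *)
Record hyperspace := Hyperspace {
  hyperspace_set :> set N;
  hyperspace_compact : compact hyperspace_set;
  hyperspace_nonempty : hyperspace_set !=set0 }.

Definition set_ball (X : set N) (e : R) : set N := \bigcup_(x in X) ball x e.

Definition hausdorff_dist (X Y : set N) : R :=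
  inf [set e | [/\ 0 < e, X `<=` set_ball Y e & Y `<=` set_ball X e]].

Implicit Types X Y Z : hyperspace.

Let E (X Y : set N) :=
  [set e : R | [/\ 0 < e, X `<=` set_ball Y e & Y `<=` set_ball X e]].

Let E_lb X Y : has_lbound (E X Y).
Proof. by exists 0 => e [/ltW]. Qed.

Let compact_bounded X (p : N) : exists2 r, 0 < r & X `<=` ball p r.
Proof.
have /compact_near_coveringP := @hyperspace_compact X.
move=> /(_ R +oo (fun r x => mdist p x < r) _) Xp.
have [|M [_ XM]] := Xp.
  move=> x _; exists (ball x 1, [set r | mdist p x + 1 < r]) => /=.
    split; first exact: nbhsx_ballx.
    by exists (mdist p x + 1); split => //; exact: num_real.
  move=> [y r] /= []; rewrite ballEmdist/= => xy; apply: le_lt_trans.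
  by rewrite (le_trans (metric_triangle _ x _))// lerD2l ltW.
exists (Num.max M 0 + 1).
  by rewrite ltr_wpDl// le_max lexx orbT.
move=> x Xx; rewrite ballEmdist/=; apply: XM => //.
by rewrite ltr_pwDr// le_max lexx.
Qed.

Let E_nonempty X Y : E X Y !=set0.
Proof.
have [x Xx] := hyperspace_nonempty X; have [y Yy] := hyperspace_nonempty Y.
have [r r0 Xr] := compact_bounded X y; have [s s0 Ys] := compact_bounded Y x.
exists (r + s); split; first exact: addr_gt0.
- move=> z /Xr yz; exists y => //.
  by apply: le_ball yz; rewrite lerDl ltW.
- move=> z /Ys xz; exists x => //.
  by apply: le_ball xz; rewrite lerDr ltW.
Qed.

Let E_inf X Y : has_inf (E X Y).
Proof. by split; [exact: E_nonempty|exact: E_lb]. Qed.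

Let E_self X e : 0 < e -> E X X e.
Proof. by move=> e0; split => // x Xx; exists x => //; exact: ballxx. Qed.

Let dist_ge0 X Y : 0 <= hausdorff_dist X Y.
Proof. by apply: (lb_le_inf (E_nonempty X Y)) => e [/ltW]. Qed.

Let distxx X : hausdorff_dist X X = 0.
Proof.
apply/eqP; rewrite eq_le dist_ge0 andbT; apply/ler_addgt0Pl => e e0.
by rewrite addr0; apply: (ge_inf (E_lb X X)); exact: E_self.
Qed.

Let dist_sym X Y : hausdorff_dist X Y = hausdorff_dist Y X.
Proof.
by congr inf; apply/seteqP; split => e [? ? ?]; split.
Qed.

Let hyperspace_inj X Y : X = Y :> set N -> X = Y.
Proof.
case: X Y => [X cX X0] [Y cY Y0] /= XY; rewrite -{}XY in cY Y0 *.
by congr Hyperspace; exact: Prop_irrelevance.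
Qed.

Let dist0_sub X Y : hausdorff_dist X Y = 0 -> X `<=` Y.
Proof.
move=> XY0 x Xx.
have cY : closed Y.
  apply: compact_closed (@hyperspace_compact Y); exact: metric_hausdorff.
apply: cY => B /nbhs_ballP[e /= e0 xeB].
have [d [d0 XYd _] de] := inf_lt (E_nonempty X Y) (ltac:(by rewrite XY0) :
  hausdorff_dist X Y < e).
have [y Yy yx] := XYd x Xx; exists y; split => //; apply: xeB.
by apply: ball_sym; exact: le_ball (ltW de) _ yx.
Qed.

Let dist_positivity X Y : hausdorff_dist X Y = 0 -> X = Y.
Proof.
move=> XY0; apply/hyperspace_inj/seteqP; split; first exact: dist0_sub.
by apply: dist0_sub; rewrite dist_sym.
Qed.

Let dist_triangle Y X Z :
  hausdorff_dist X Z <= hausdorff_dist X Y + hausdorff_dist Y Z.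
Proof.
apply/ler_addgt0Pl => e e0; have e20 : 0 < e / 2 by rewrite divr_gt0.
have [a [a0 XYa YXa] ea] := inf_adherent e20 (E_inf X Y).
have [b [b0 YZb ZYb] eb] := inf_adherent e20 (E_inf Y Z).
apply: (@le_trans _ _ (a + b)); last first.
  rewrite [leRHS](_ : _ = hausdorff_dist X Y + e / 2
    + (hausdorff_dist Y Z + e / 2)); first by rewrite lerD// ltW.
  by rewrite addrACA -splitr addrC.
apply: (ge_inf (E_lb X Z)).
split; first exact: addr_gt0.
- move=> x /XYa[y /YZb[z Zz zy] yx]; exists z => //.
  by rewrite addrC; exact: ball_triangle zy yx.
- move=> z /ZYb[y /YXa[x Xx xy] yz]; exists x => //.
  exact: ball_triangle xy yz.
Qed.

HB.instance Definition _ := gen_eqMixin hyperspace.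
HB.instance Definition _ := gen_choiceMixin hyperspace.
HB.instance Definition _ := isMetric.Build R hyperspace
  distxx dist_positivity dist_sym dist_triangle.

End hausdorff_distance.

Section polish.
Context {R : realType}.

Definition separable (T : topologicalType) :=
  exists2 D : set T, countable D & dense D.

Definition is_metric (T : Type) (d : T -> T -> R) :=
  [/\ forall x, d x x = 0,
      forall x y, d x y = 0 -> x = y,
      forall x y, d x y = d y x &
      forall y x z, d x z <= d x y + d y z].

Definition compatible_metric (T : topologicalType) (d : T -> T -> R) :=
  forall (x : T) (A : set T),
    nbhs x A <-> exists2 e, 0 < e & [set y | d x y < e] `<=` A.

Definition complete_metric (T : topologicalType) (d : T -> T -> R) :=
  forall u : nat -> T,
    (forall e, 0 < e -> exists n0 : nat, forall m n : nat,
        (n0 <= m)%N -> (n0 <= n)%N -> d (u m) (u n) < e) ->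
    exists l : T, u @ \oo --> l.

(* Only the existence of a complete compatible metric is required: the given
   metric of a Polish metric space need not be complete. *)
Definition polish (T : topologicalType) :=
  separable T /\ exists d : T -> T -> R,
    [/\ is_metric d, compatible_metric d & complete_metric d].

End polish.
Arguments polish R T : clear implicits.

Definition homeomorphism {S T : topologicalType} (h : S -> T) :=
  continuous h /\ exists g : T -> S, [/\ cancel h g, cancel g h & continuous g].

Definition conjugate {S T : topologicalType} (f : S -> S) (g : T -> T) :=
  exists2 phi : S -> T, homeomorphism phi & g \o phi = phi \o f.

Definition cantor_metric_space {R : realType} (K : metricType R) :=
  [/\ [set: K] !=set0, compact [set: K], perfect_set [set: K] &
      totally_disconnected [set: K]].

(* As a type, homeo_group K carries the C^0 topology, induced from
   {uniform K -> K}. *)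
Definition homeo_group {R : realType} (K : metricType R) :
    set {uniform K -> K} :=
  [set h : {uniform K -> K} | homeomorphism (h : K -> K)].
Arguments homeo_group {R} K.

Definition conjugacy_class {R : realType} (K : metricType R)
    (h : homeo_group K) : set (homeo_group K) :=
  [set k : homeo_group K | conjugate (set_val h : K -> K) (set_val k)].

Definition special_homeomorphism {R : realType} (K : metricType R)
    (h : homeo_group K) :=
  [/\ cantor_metric_space K, dense (conjugacy_class h) &
      Gdelta (conjugacy_class h)].

(* As a type, DS V carries the restriction of the Hausdorff metric of the
   hyperspace of V * V, the product having the max-metric prod_mdist. *)
Definition DS {R : realType} (V : metricType R) :
    set (hyperspace (V * V)%type) :=
  [set f : hyperspace (V * V)%type | fst @` f = snd @` f].
Arguments DS {R} V.

Section special_homeomorphisms.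
Context {R : realType} {V : metricType R}.

Definition DS_graph (f : DS V) : set (V * V) := set_val f.

Definition DS_support (f : DS V) : set V := fst @` DS_graph f.

Definition is_graph_of (f : DS V) (g : DS_support f -> DS_support f) :=
  DS_graph f = [set (set_val x, set_val (g x)) | x in [set: DS_support f]].

Definition DS_SH : set (DS V) :=
  [set f : DS V | cantor_metric_space (DS_support f) /\
    exists g : DS_support f -> DS_support f,
    [/\ is_graph_of g, homeomorphism g &
        exists (K : metricType R) (h : homeo_group K),
          special_homeomorphism h /\ conjugate g (set_val h : K -> K)]].

End special_homeomorphisms.
Arguments DS_SH {R} V.

(* Main.v *)
Require Import Defs.
From mathcomp Require Import all_boot all_order all_algebra.
From mathcomp Require Import all_classical all_reals all_analysis borel_hierarchy.
From mathcomp Require Import lra.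

Set Implicit Arguments.
Unset Strict Implicit.
Unset Printing Implicit Defensive.

Import Order.TTheory GRing.Theory Num.Theory.

Local Open Scope classical_set_scope.
Local Open Scope ring_scope.

(* Call a total relation on a finite set splittable if its vertices divide into
   "right" ones, with a unique successor, which is again right, and "left" ones,
   with a unique predecessor, which is again left. Over a splittable relation any
   two finite covers amalgamate, and every finite total relation has a splittable
   cover. Accordingly, call a compact total relation F generic if it has arbitrarily
   fine finite clopen colourings whose transition graph B is splittable and over
   which every finite cover of B, of size bounded relatively to B, is realized by
   finer colourings. Genericity is a G_delta condition by its form; a
   back-and-forth argument shows that any two generic relations are isomorphic.
   On a Cantor space K every cover of a transition graph is realized by a nearby
   homeomorphism, so by the Baire property the generic homeomorphisms are dense in
   H(K) and they form the conjugacy class of the Special Homeomorphism. Hence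
   f in DS(V) is conjugate to the Special Homeomorphism iff it is generic. For
   density, a finite net of f gives a total relation on finitely many points of V,
   which is the transition graph of a generic homeomorphism of a Cantor set lying
   close to these points. *)

(** Genericity is stated for compact relations, not for maps, because an element of [DS V] need be
    neither a graph nor carried by a Cantor set. That a generic relation is the graph of a
    homeomorphism of a Cantor set is never checked directly: it is inherited, through uniqueness,
    from one generic homeomorphism. Openness of a stage is likewise proved once, for relations that
    are Hausdorff close, and serves both in H(K) and in DS(V). The obstacle to amalgamation is that
    a walk in a fibre product gets stuck when the successors in the two covers lie over different
    vertices. Over a right vertex there is no choice of successor, and dually over a left one, so
    walks continue by themselves; an edge from left to right lifts freely in both directions. *)

Local Notation dom F := (fst @` F).

(** * Finite relations *)

Section relations.

Definition img (S T : Type) (a : S -> T) (F : set (S * S)) : set (T * T) :=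
  (fun p => (a p.1, a p.2)) @` F.

Definition total_rel (S : Type) (F : set (S * S)) := fst @` F = snd @` F.

Lemma img_comp (S T U : Type) (a : S -> T) (b : T -> U) F :
  img b (img a F) = img (b \o a) F.
Proof. by rewrite /img image_comp. Qed.

Lemma img_id (S : Type) (F : set (S * S)) : img id F = F.
Proof. by rewrite /img -[RHS]image_id; apply: eq_imagel => -[]. Qed.

Lemma img_fst (S T : Type) (a : S -> T) F : fst @` img a F = a @` (fst @` F).
Proof. by rewrite /img !image_comp. Qed.

Lemma img_snd (S T : Type) (a : S -> T) F : snd @` img a F = a @` (snd @` F).
Proof. by rewrite /img !image_comp. Qed.

Lemma img_total (S T : Type) (a : S -> T) F :
  total_rel F -> total_rel (img a F).
Proof. by rewrite /total_rel img_fst img_snd => ->. Qed.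

Lemma total_relP (S : Type) (F : set (S * S)) : total_rel F <->
  (forall x y, F (x, y) -> exists z, F (y, z)) /\
  (forall x y, F (x, y) -> exists z, F (z, x)).
Proof.
split=> [FF|[F1 F2]].
  split=> x y Fxy.
    have : (snd @` F) y by exists (x, y).
    by rewrite -FF => -[[a b] Fab /= <-]; exists b.
  have : (fst @` F) x by exists (x, y).
  by rewrite FF => -[[a b] Fab /= <-]; exists a.
apply/seteqP; split=> _ [[x y] Fxy /= <-].
  by have [z Fz] := F2 _ _ Fxy; exists (z, x).
by have [z Fz] := F1 _ _ Fxy; exists (y, z).
Qed.

Lemma eq_img (S T : Type) (a b : S -> T) F : total_rel F ->
  (forall x, (fst @` F) x -> a x = b x) -> img a F = img b F.
Proof.
move=> FF ab; apply: eq_imagel => -[x y] Fxy /=.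
rewrite (ab x); last by exists (x, y).
by rewrite (ab y)// FF; exists (x, y).
Qed.

Definition split_rel (S : Type) (E : set (S * S)) (r : set S) :=
  (forall x y, E (x, y) -> r x -> r y /\ forall z, E (x, z) -> z = y) /\
  (forall x y, E (x, y) -> ~ r y -> ~ r x /\ forall z, E (z, y) -> z = x).

Definition splittable (S : Type) (E : set (S * S)) := exists r, split_rel E r.

(* The cover consists of a left copy of [E] cut down to one chosen predecessor per
   vertex, a right copy cut down to one chosen successor per vertex, and all edges
   of [E] going from left to right. *)
Lemma splittable_cover (S : Type) (E : set (S * S)) : total_rel E ->
  exists B : set ((S * bool) * (S * bool)),
    [/\ total_rel B, splittable B & img fst B = E].
Proof.
move=> /total_relP[Es Ep].
have [nx nxE] : {nx & forall y, (exists z, E (y, z)) -> E (y, nx y)}.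
  apply: (@boolp.choice _ _ (fun y z => (exists z, E (y, z)) -> E (y, z))) => y.
  by have [[z Ez]|] := pselect (exists z, E (y, z)); [exists z|exists y].
have [pv pvE] : {pv & forall y, (exists z, E (z, y)) -> E (pv y, y)}.
  apply: (@boolp.choice _ _ (fun y z => (exists z, E (z, y)) -> E (z, y))) => y.
  by have [[z Ez]|] := pselect (exists z, E (z, y)); [exists z|exists y].
have nxP x y : E (x, y) -> E (y, nx y) by move=> /Es/nxE.
have pvP x y : E (x, y) -> E (pv x, x) by move=> /Ep/pvE.
pose B : set ((S * bool) * (S * bool)) := [set e |
  E (e.1.1, e.2.1) /\ match e.1.2, e.2.2 with
  | false, false => e.1.1 = pv e.2.1
  | true, true => e.2.1 = nx e.1.1
  | false, true => True
  | true, false => False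
  end].
exists B; split.
- apply/total_relP; split=> -[x []] [y []] [/= Exy]//= _.
  + exists (nx y, true); split => //=; exact: nxP Exy.
  + exists (nx y, true); split => //=; exact: nxP Exy.
  + exists (nx y, true); split => //=; exact: nxP Exy.
  + exists (pv x, false); split => //=; exact: pvP Exy.
  + exists (pv x, false); split => //=; exact: pvP Exy.
  + exists (pv x, false); split => //=; exact: pvP Exy.
- exists (fun z : S * bool => z.2); split=> -[x []] [y []] [/= Exy]//=.
    by move=> -> _; split=> // -[z []] [/= Exz]// ->.
  by move=> -> _; split=> // -[z []] [/= Exz]// ->.
- apply/seteqP; split=> [_ [[[x b] [y c]] [/= Exy _]] <-//|[x y] Exy].
  by exists ((x, false), (y, true)).
Qed.

End relations.

(** If each [t] failed at some index, all would fail at the largest of these finitely many indices.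
    This turns walks of every finite length into infinite ones. *)
Lemma antitone_pigeonhole (T : finType) (P : nat -> T -> Prop) :
  (forall n t, P n.+1 t -> P n t) -> (forall n, exists t, P n t) ->
  exists t, forall n, P n t.
Proof.
move=> Pd Pex; apply: contrapT => noP.
have {}noP t : exists n, ~ P n t.
  by apply: contrapT => nn; apply: noP; exists t => n; apply: contrapT => np;
    apply: nn; exists n.
have [g gP] := boolp.choice noP.
have Pm n k t : (n <= k)%N -> P k t -> P n t.
  elim: k => [|k IH]; first by case: n.
  by rewrite leq_eqVlt; case/predU1P=> [->//|nk /Pd]; exact: IH.
have [t Pt] := Pex (\max_t g t)%N.
apply: (gP t); apply: Pm Pt; exact: leq_bigmax.
Qed.

(** * Amalgamation of covers over a splittable relation *)

Section amalgamation.

Fixpoint fwd (S : Type) (E : set (S * S)) n (x : S) : Prop :=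
  if n is n'.+1 then exists2 y, E (x, y) & fwd E n' y else True.

Definition converse (S : Type) (E : set (S * S)) : set (S * S) :=
  [set e | E (e.2, e.1)].

Lemma fwdS (S : Type) (E : set (S * S)) n x : fwd E n.+1 x -> fwd E n x.
Proof.
elim: n x => // n IH x [y Exy fy]; exists y => //; exact: IH.
Qed.

Definition fibre_product (S T B : Type) (p : S -> B) (q : T -> B)
    (E : set (S * S)) (F : set (T * T)) : set ((S * T) * (S * T)) :=
  [set e | [/\ E (e.1.1, e.2.1), F (e.1.2, e.2.2), p e.1.1 = q e.1.2 &
    p e.2.1 = q e.2.2]].

(* By the pigeonhole principle, on a finite type these are the edges lying on
   bi-infinite walks. *)
Definition core (S : Type) (E : set (S * S)) : set (S * S) :=
  [set e | [/\ E e, forall n, fwd E n e.2 & forall n, fwd (converse E) n e.1]].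

Lemma core_total (S : finType) (E : set (S * S)) : total_rel (core E).
Proof.
apply/total_relP; split=> x y [/= Exy fy bx].
- have [|n|z zP] := @antitone_pigeonhole S (fun n z => E (y, z) /\ fwd E n z).
  + by move=> n z [Eyz f]; split=> //; exact: fwdS f.
  + by have /= [z Eyz fz] := fy n.+1; exists z.
  + exists z; split => [|n|n] /=; first by case: (zP 0%N).
      by case: (zP n).
    by case: n => // n; exists x => //; exact: bx.
- have [|n|z zP] := @antitone_pigeonhole S
      (fun n z => E (z, x) /\ fwd (converse E) n z).
  + by move=> n z [Eyz f]; split=> //; exact: fwdS f.
  + by have /= [z Eyz fz] := bx n.+1; exists z.
  + exists z; split => [|n|n] /=; first by case: (zP 0%N).
      by case: n => // n; exists y => //; exact: fy.
    by case: (zP n).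
Qed.

Lemma converse_total (S : Type) (E : set (S * S)) :
  total_rel E -> total_rel (converse E).
Proof. by move=> /total_relP[Es Ep]; apply/total_relP; split=> x y; [exact: Ep|exact: Es]. Qed.

Lemma img_converse (S T : Type) (a : S -> T) (E : set (S * S)) :
  img a (converse E) = converse (img a E).
Proof.
by apply/seteqP; split=> [_ [[x y] Exy <-]|[_ _] [[x y] Exy [<- <-]]];
  exists (y, x).
Qed.

Lemma split_converse (S : Type) (E : set (S * S)) (r : set S) :
  split_rel E r -> split_rel (converse E) (~` r).
Proof.
move=> [r1 r2]; split=> x y Exy rx; first exact: r2 Exy rx.
have [rx' u] := r1 _ _ Exy (contrapT rx); split=> //; exact.
Qed.

Lemma fibre_product_converse (S T B : Type) (p : S -> B) (q : T -> B) E F :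
  fibre_product p q (converse E) (converse F) = converse (fibre_product p q E F).
Proof. by apply/seteqP; split=> -[[a b] [c d]] [/= ? ? ? ?]. Qed.

Section fibre_walks.
Variables (S T B : finType) (p : S -> B) (q : T -> B).
Variables (E : set (S * S)) (F : set (T * T)) (G : set (B * B)).
Hypotheses (Et : total_rel E) (Ft : total_rel F).
Hypotheses (pE : img p E = G) (qF : img q F = G).

Let FP := fibre_product p q E F.

Let EG x y : E (x, y) -> G (p x, p y). Proof. by rewrite -pE; exists (x, y). Qed.
Let FG x y : F (x, y) -> G (q x, q y). Proof. by rewrite -qF; exists (x, y). Qed.

(** Over a right vertex the base offers a single successor, so arbitrary successors of [x] and [y]
    stay over a common vertex. The incoming edges ensure that [x] and [y] are vertices, hence have
    successors. *)
Lemma fwd_fibre r n x y x' y' : split_rel G r -> p x = q y -> r (p x) ->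
  E (x', x) -> F (y', y) -> fwd FP n (x, y).
Proof.
move=> [rs _]; have [/total_relP[En _] /total_relP[Fn _]] := (Et, Ft).
elim: n x y x' y' => // n IH x y x' y' pq rx Ex Fy.
have [z Exz] := En _ _ Ex; have [t Fyt] := Fn _ _ Fy.
have [rz u] := rs _ _ (EG Exz) rx.
have pqz : p z = q t by apply/esym/u; rewrite pq; exact: FG.
by exists (z, t) => //; exact: IH pqz rz Exz Fyt.
Qed.

Lemma bwd_fibre r n x y x' y' : split_rel G r -> p x = q y -> ~ r (p x) ->
  E (x, x') -> F (y, y') -> fwd (converse FP) n (x, y).
Proof.
move=> [_ rs]; have [/total_relP[_ En] /total_relP[_ Fn]] := (Et, Ft).
elim: n x y x' y' => // n IH x y x' y' pq rx Ex Fy.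
have [z Exz] := En _ _ Ex; have [t Fyt] := Fn _ _ Fy.
have [rz u] := rs _ _ (EG Exz) rx.
have pqz : p z = q t by apply/esym/u; rewrite pq; exact: FG.
by exists (z, t) => //=; exact: IH pqz rz Exz Fyt.
Qed.

(* A backward walk of [E] over right vertices either stays there or comes from a
   left vertex; in both cases it is lifted from its far end, going forward. *)
Lemma bwd_lift r n x x' : split_rel G r -> r (p x) -> E (x', x) ->
  exists y y', [/\ p x = q y, F (y', y) & fwd (converse FP) n (x, y)].
Proof.
move=> Gr; have [rs _] := Gr.
have [/total_relP[_ En] /total_relP[Fn _]] := (Et, Ft).
elim: n x x' => [|n IH] x x' rx Ex.
  have := EG Ex; rewrite -qF => -[[y' y] Fy [_ ?]]; exists y, y'; split => //.
have [rx'|rx'] := pselect (r (p x')).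
  have [x2 Ex2] := En _ _ Ex.
  have [y [y' [pqx' Fy wy]]] := IH _ _ rx' Ex2.
  have [z Fyz] := Fn _ _ Fy; exists z, y.
  have [_ u] := rs _ _ (EG Ex) rx'.
  have pqz : p x = q z by apply/esym/u; rewrite pqx'; exact: FG.
  by split=> //; exists (x', y).
have := EG Ex; rewrite -qF => -[[y' y] Fy [qy' qy]]; exists y, y'; split => //.
exists (x', y'); first by split.
by apply: bwd_fibre Gr _ rx' Ex Fy; rewrite qy'.
Qed.

(** An edge from a left to a right vertex lifts freely at both ends. If the source is right, the
    delicate side is the past: [bwd_lift] gives partners with backward walks of each length,
    pigeonhole gives one partner for all lengths, and its future is automatic. *)
Lemma core_lift_right r x x' : split_rel G r -> E (x, x') -> r (p x') ->
  exists y y', core FP ((x, y), (x', y')).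
Proof.
move=> Gr Ex rx'.
have [/total_relP[En Ep] /total_relP[Fn Fp]] := (Et, Ft).
have [rx|rx] := pselect (r (p x)); last first.
  have := EG Ex; rewrite -qF => -[[y y'] Fy [qy qy']].
  exists y, y'; split=> //= n; first exact: fwd_fibre Gr _ _ Ex Fy.
  exact: bwd_fibre Gr _ _ Ex Fy.
have [x2 Ex2] := Ep _ _ Ex.
have [|n|y yP] := @antitone_pigeonhole T (fun n y =>
   exists y', [/\ p x = q y, F (y', y) & fwd (converse FP) n (x, y)]).
- by move=> n y [y' [? ? ?]]; exists y'; split=> //; exact: fwdS.
- by have [y [y' yP]] := bwd_lift n Gr rx Ex2; exists y, y'.
have [y0 [pqy Fy _]] := yP 0%N; have [y' Fy'] := Fn _ _ Fy.
have [_ u] := Gr.1 _ _ (EG Ex) rx.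
have pqz : p x' = q y' by apply/esym/u; rewrite pqy; exact: FG.
exists y, y'; split=> //= n; first exact: fwd_fibre Gr _ _ Ex Fy'.
by have [? []] := yP n.
Qed.

End fibre_walks.

(** An edge ending at a left vertex also starts at one; reversing all arrows exchanges left and
    right and reduces this to [core_lift_right]. *)
Lemma core_lift (S T B : finType) (p : S -> B) (q : T -> B) E F G r x x' :
  total_rel E -> total_rel F -> img p E = G -> img q F = G -> split_rel G r ->
  E (x, x') -> exists y y', core (fibre_product p q E F) ((x, y), (x', y')).
Proof.
move=> Et Ft pE qF Gr Ex.
have [rx'|rx'] := pselect (r (p x')); first exact: core_lift_right Gr Ex rx'.
have [_ rs] := Gr.
have Gxx : G (p x, p x') by rewrite -pE; exists (x, x').
have [rx _] := rs _ _ Gxx rx'.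
have := @core_lift_right S T B p q (converse E) (converse F) (converse G).
move=> /(_ (converse_total Et) (converse_total Ft)).
rewrite !img_converse pE qF => /(_ erefl erefl (~` r) x' x).
move=> /(_ (split_converse Gr) Ex rx)[y' [y]].
by rewrite fibre_product_converse => -[? ? ?]; exists y, y'; split.
Qed.

(** Passing to the core removes the dead ends of the fibre product, and [core_lift] says that no
    edge of either factor is lost. *)
Lemma amalgamation (S T B : finType) (p : S -> B) (q : T -> B) E F :
  total_rel E -> total_rel F -> img p E = img q F -> splittable (img p E) ->
  exists G : set ((S * T) * (S * T)), [/\ total_rel G, img fst G = E,
    img snd G = F & forall z, (fst @` G) z -> p z.1 = q z.2].
Proof.
move=> Et Ft pq [r Gr]; exists (core (fibre_product p q E F)); split.
- exact: core_total.
- apply/seteqP; split=> [_ [[x y] [[/= ? ? ? ?] _ _] <-]//|[x x'] Ex].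
  have [y [y' c]] := core_lift Et Ft erefl (esym pq) Gr Ex.
  by exists ((x, y), (x', y')).
- apply/seteqP; split=> [_ [[x y] [[/= ? ? ? ?] _ _] <-]//|[y y'] Fy].
  (* The roles of [E] and [F] are exchanged, so the walks obtained are transposed by induction on
     their length. *)
  have [x [x' [[/= E1 F1 p1 p2] f b]]] := core_lift Ft Et (esym pq) erefl Gr Fy.
  exists ((x, y), (x', y')) => //; split=> //= n.
    have {f b} := f n; move: (x') (y') => {x x' y y' Fy E1 F1 p1 p2}.
    elim: n => // n IH x y [[y1 x1] [/= Exy Fxy pq1 pq2] /IH f].
    by exists (x1, y1).
  have {f b} := b n; move: (x) (y) => {x x' y y' Fy E1 F1 p1 p2}.
  elim: n => // n IH x y [[y1 x1] [/= Exy Fxy pq1 pq2] /IH f].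
  by exists (x1, y1).
- by move=> _ [[x y] [[]]] /= ? ? ? ? _ _ <-.
Qed.

End amalgamation.

(** * Covers dominating all covers of bounded size *)

Section domination.

(* Only quotients carried by ['I_n * B] are considered, so that a single finite [E]
   can dominate all of them; this is what makes genericity a G_delta condition. *)
Definition dominates (J B : finType) (n : nat) (E : set (J * J)) (q : J -> B) :=
  forall C : set (('I_n * B) * ('I_n * B)), total_rel C ->
    img snd C = img q E ->
    exists2 s : J -> 'I_n * B, img s E = C &
      forall j, (fst @` E) j -> (s j).2 = q j.

(** Only finitely many relations live on ['I_n * B]; encoded as finite sets, they are enumerated and
    amalgamated into the cover one after the other. Those treated earlier remain dominated because
    the new cover projects onto the old one. *)
Lemma dominating_cover (B : finType) (n : nat) (E : set (B * B)) :
  total_rel E -> splittable E ->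
  exists (J : finType) (F : set (J * J)) (q : J -> B),
    [/\ total_rel F, img q F = E & dominates n F q].
Proof.
move=> Et Es; pose T := ('I_n * B)%type.
suff /(_ (enum {set T * T}))[J [F [q [Ft qF dF]]]] : forall l : seq {set T * T},
    exists (J : finType) (F : set (J * J)) (q : J -> B),
    [/\ total_rel F, img q F = E & forall X, X \in l ->
      let C := [set e | e \in X] in
      total_rel C -> img snd C = E ->
      exists2 s : J -> T, img s F = C &
        forall j, (fst @` F) j -> (s j).2 = q j].
  exists J, F, q; split=> // C Ct; rewrite qF => CE.
  have XC : [set e | e \in [set e | `[<C e>]]%SET] = C.
    by apply/seteqP; split=> e; rewrite /= inE => /asboolP.
  have := dF [set e | `[<C e>]]%SET; rewrite /= XC; apply=> //.
  exact: mem_enum.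
elim=> [|X l [J [F [q [Ft qF dF]]]]].
  by exists B, E, id; split=> //; rewrite img_id.
have [[Xt XE]|nX] := pselect
    (total_rel [set e | e \in X] /\ img snd [set e | e \in X] = E); last first.
  exists J, F, q; split=> // Y; rewrite inE => /predU1P[->|/dF//].
  by move=> C Ct CE; exfalso; exact: nX.
have [||G [Gt GF GX Gq]] := amalgamation (p := q) (q := snd) Ft Xt.
- by rewrite qF XE.
- by rewrite qF.
exists (J * T)%type, G, (q \o fst); split=> //.
  by rewrite -img_comp GF qF.
move=> Y; rewrite inE => /predU1P[->|/dF{}dF] C Ct CE.
  by exists snd => // z /Gq/esym.
have [s sF sq] := dF Ct CE; exists (s \o fst); first by rewrite -img_comp GF.
by move=> z Gz; apply: sq; rewrite -GF img_fst; exists z.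
Qed.

End domination.

(** * Colourings and generic relations *)

Section colorings.
Context {R : realType}.
Implicit Types X Y : metricType R.

(* The uniformity in [d] costs nothing: on a compact set it amounts to local
   constancy. *)
Definition colouring X (T : Type) (M : set X) (a : X -> T) :=
  exists2 d : R, 0 < d &
    forall x y, M x -> M y -> mdist x y < d -> a x = a y.

(** The strict inequality [d < e] leaves room for a perturbation, which makes fineness an open
    condition. *)
Definition fine X (T : Type) (M : set X) (a : X -> T) (e : R) :=
  exists2 d : R, d < e &
    forall x y, M x -> M y -> a x = a y -> mdist x y <= d.

Lemma fine_lt X (T : Type) (M : set X) (a : X -> T) e x y :
  fine M a e -> M x -> M y -> a x = a y -> mdist x y < e.
Proof. by move=> [d de ad] Mx My axy; apply: le_lt_trans de; exact: ad. Qed.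

Lemma fineW X (T : Type) (M : set X) (a : X -> T) e f :
  e <= f -> fine M a e -> fine M a f.
Proof. by move=> ef [d de ad]; exists d => //; exact: lt_le_trans ef. Qed.

Lemma fine_comp X (S T : Type) (M : set X) (a : X -> T) (b : X -> S)
    (r : S -> T) e :
  (forall x, M x -> r (b x) = a x) -> fine M a e -> fine M b e.
Proof.
by move=> rba [d de ad]; exists d => // x y Mx My bxy; apply: ad; rewrite // -!rba// bxy.
Qed.

Lemma colouring_comp X (S T : Type) (M : set X) (b : X -> S) (r : S -> T) :
  colouring M b -> colouring M (r \o b).
Proof.
by move=> [d d0 bd]; exists d => // x y Mx My /bd/= ->.
Qed.

Lemma colouring_prod X (S T : Type) (M : set X) (a : X -> S) (b : X -> T) :
  colouring M a -> colouring M b -> colouring M (fun x => (a x, b x)).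
Proof.
move=> [d d0 ad] [e e0 be]; exists (Num.min d e); first by rewrite lt_min d0.
by move=> x y Mx My; rewrite lt_min => /andP[xd xe]; rewrite (ad x y)// (be x y).
Qed.

Lemma factor (X S T : Type) (M : set X) (a : X -> T) (b : X -> S) :
  M !=set0 -> (forall x y, M x -> M y -> b x = b y -> a x = a y) ->
  exists r : S -> T, forall x, M x -> r (b x) = a x.
Proof.
move=> [x0 Mx0] ba.
have [r rP] : {r & forall s, (exists2 x, M x & b x = s) ->
    exists x, [/\ M x, b x = s & r s = a x]}.
  apply: (@boolp.choice _ _ (fun s t => (exists2 x, M x & b x = s) ->
    exists x, [/\ M x, b x = s & t = a x])) => s.
  have [[x Mx bx]|] := pselect (exists2 x, M x & b x = s).
    by exists (a x) => _; exists x.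
  by exists (a x0).
exists r => x Mx; have [|y [My bxy ->]] := rP (b x); first by exists x.
exact: ba.
Qed.

(* [img a F] is the finite transition graph of [F] between the colour classes of
   [a]. *)
Definition generic_stage X (F : set (X * X)) (e : R) (n : nat) :=
  exists (J B : finType) (b : X -> J) (q : J -> B),
    [/\ colouring (dom F) b, splittable (img (q \o b) F),
        fine (dom F) (q \o b) e & dominates n (img b F) q].

Definition generic X (F : set (X * X)) :=
  forall e n, 0 < e -> generic_stage F e n.

Lemma generic_fine X (F : set (X * X)) e : generic F -> 0 < e ->
  exists (B : finType) (a : X -> B),
    [/\ colouring (dom F) a, splittable (img a F) & fine (dom F) a e].
Proof.
move=> gF e0; have [J [B [b [q [bc bs bf _]]]]] := gF e 0%N e0.
exists B, (q \o b); split=> //; exact: colouring_comp.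
Qed.

(* The colours [C] prescribed over [a] and the colouring given by genericity are
   amalgamated; since the amalgam is carried by ['I_#|C| * B'], it is realized. *)
Lemma generic_extension X (F : set (X * X)) (B C : finType) (a : X -> B)
    (p : C -> B) (E : set (C * C)) :
  total_rel F -> F !=set0 -> generic F ->
  colouring (dom F) a -> splittable (img a F) -> total_rel E ->
  img p E = img a F ->
  exists c : X -> C, [/\ colouring (dom F) c, img c F = E &
    forall x, dom F x -> p (c x) = a x].
Proof.
move=> Ft [z Fz] gF ac asp Et pE.
have M0 : dom F !=set0 by exists z.1; exists z.
(* A colouring finer than the constant of [a] determines [a]. *)
have [d d0 df] : exists2 d, 0 < d & forall S (b : X -> S), fine (dom F) b d ->
    exists r : S -> B, forall x, dom F x -> r (b x) = a x.
  case: ac => d d0 ad; exists d => // S b bd; apply: factor => // x y Mx My bxy.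
  by apply: ad => //; exact: fine_lt bd _ _ bxy.
have [J [B' [b [q [bc bs bf bd]]]]] := gF d #|C| d0.
have [r ra] := df _ _ bf.
have qFt : total_rel (img (q \o b) F) by exact: img_total.
have raF : img r (img (q \o b) F) = img a F.
  by rewrite img_comp; exact: eq_img.
have [||G [Gt GE GF Gpr]] := amalgamation (p := p) (q := r) Et qFt.
- by rewrite raF.
- by rewrite pE.
pose k (z : C * B') := (enum_rank z.1, z.2).
have [||s sG sq] := bd (img k G).
- exact: img_total.
- by rewrite [LHS]img_comp -[snd \o k]/(@snd C B') GF img_comp.
pose g (w : 'I_#|C| * B') := enum_val w.1.
have gk : g \o k = fst by apply/funext => w; rewrite /g/= enum_rankK.
exists (g \o s \o b); split.
- exact: (colouring_comp (g \o s)).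
- by rewrite -[g \o s \o b]compA -img_comp -[img _ F]img_comp sG img_comp gk.
- move=> x Fx; rewrite -ra//=.
  have bFx : dom (img b F) (b x) by rewrite img_fst; exists x.
  rewrite -(sq _ bFx).
  have : dom (img k G) (s (b x)) by rewrite -sG img_fst; exists (b x).
  rewrite img_fst => -[w Gw <-]; rewrite /g/= enum_rankK; exact: Gpr.
Qed.

End colorings.

(** * Back and forth *)

Section metric_facts.
Context {R : realType}.
Implicit Types X Y : metricType R.

Lemma exists_natSinv (e : R) : 0 < e -> exists n : nat, n.+1%:R^-1 < e.
Proof.
by move=> e0; have := near_infty_natSinv_lt (PosNum e0) => /filter_ex.
Qed.

Lemma mdist_eq0 X (x y : X) : (forall e, 0 < e -> mdist x y < e) -> x = y.
Proof.
move=> xy; apply: mdist_positivity; apply/eqP; rewrite eq_le mdist_ge0 andbT.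
by apply/ler_addgt0Pl => e e0; rewrite addr0 ltW// xy.
Qed.

Lemma compact_seq_cluster X (M : set X) (u : nat -> X) :
  compact M -> (forall n, M (u n)) ->
  exists2 x, M x & forall e n, 0 < e ->
    exists2 m, (n <= m)%N & mdist x (u m) < e.
Proof.
move=> cM Mu; have [|x [Mx xu]] := cM (u @ \oo).
  by exists 0%N => // n _; exact: Mu.
exists x => // e n e0.
have [|y [[m nm <-] xm]] := xu [set u m | m in [set m | (n <= m)%N]] _ _
  (nbhsx_ballx x e e0).
  by exists n => // m nm; exists m.
by exists m => //; move: xm; rewrite ballEmdist.
Qed.

End metric_facts.

Section back_and_forth.
Context {R : realType} (X Y : metricType R) (M : set X) (N : set Y).
Variable matched : forall T : finType, (X -> T) -> (Y -> T) -> Prop.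
Hypotheses (cM : compact M) (cN : compact N) (M0 : M !=set0).
Hypothesis matchedP : forall (T : finType) (a : X -> T) (b : Y -> T),
  matched a b -> [/\ colouring M a, colouring N b & a @` M = b @` N].
Hypothesis refine : forall (T : finType) (a : X -> T) (b : Y -> T) (e : R),
  0 < e -> matched a b ->
  exists (S : finType) (c : X -> S) (d : Y -> S) (r : S -> T),
  [/\ matched c d, forall x, M x -> r (c x) = a x,
      forall y, N y -> r (d y) = b y, fine M c e & fine N d e].

Record match_state := MatchState {
  state_type : finType;
  state_left : X -> state_type;
  state_right : Y -> state_type;
  state_matched : matched state_left state_right }.

Let refines (s t : match_state) (e : R) :=
  exists r : state_type t -> state_type s,
  [/\ forall x, M x -> r (state_left t x) = state_left s x,
      forall y, N y -> r (state_right t y) = state_right s y,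
      fine M (state_left t) e & fine N (state_right t) e].

(** The colour classes of the [t n] are nonempty and decreasing; a cluster point of witnesses lies
    in all of them since colourings are locally constant. *)
Lemma match_exists (Z : metricType R) (P : set Z) (T : nat -> Type)
    (t : forall n, T n) (b : forall n, Z -> T n) : compact P ->
  (forall n, colouring P (b n)) -> (forall n, exists2 y, P y & b n y = t n) ->
  (forall n y, P y -> b n.+1 y = t n.+1 -> b n y = t n) ->
  exists2 y, P y & forall n, b n y = t n.
Proof.
move=> cP bc bt tt.
have btP n : exists y, P y /\ b n y = t n by have [y] := bt n; exists y.
have [u uP] := boolp.choice btP.
have tt' n m y : (n <= m)%N -> P y -> b m y = t m -> b n y = t n.
  elim: m => [|m IH]; first by case: n.
  rewrite leq_eqVlt; case/predU1P=> [->//|nm Py /tt]; move=> /(_ Py); exact: IH.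
have [|y Py yu] := compact_seq_cluster (u := u) cP; first by move=> n; case: (uP n).
exists y => // n; have [d d0 bd] := bc n.
have [m nm yum] := yu d n d0; have [Pum bum] := uP m.
by rewrite (bd _ _ Py Pum yum); exact: tt' bum.
Qed.

(** Points are related when they have the same colour at every stage. Compactness gives each point a
    partner, and fineness makes it unique. The last clause retains the stages, from which uniform
    continuity and the action on relations are read off. *)
Theorem back_and_forth (T : finType) (a : X -> T) (b : Y -> T) :
  matched a b ->
  exists (f : X -> Y) (g : Y -> X),
  [/\ forall x, M x -> N (f x) /\ g (f x) = x,
      forall y, N y -> M (g y) /\ f (g y) = y,
      forall x, M x -> b (f x) = a x &
      forall e, 0 < e -> exists (S : finType) (c : X -> S) (d : Y -> S),
        [/\ matched c d, fine M c e, fine N d e &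
            forall x, M x -> d (f x) = c x]].
Proof.
move=> ab.
have [st stP] : {st : nat * match_state -> match_state &
    forall ns, refines ns.2 (st ns) ns.1.+1%:R^-1}.
  apply: (@boolp.choice _ _ (fun ns t => refines ns.2 t ns.1.+1%:R^-1)).
  move=> [n s] /=; have n0 : 0 < n.+1%:R^-1 :> R by rewrite invr_gt0.
  have [S [c [d [r [cd rc rd cf df]]]]] := refine n0 (state_matched s).
  by exists (MatchState cd), r.
pose s := fix s n := if n is m.+1 then st (m, s m) else MatchState ab.
have sP n : refines (s n) (s n.+1) n.+1%:R^-1 by exact: stP (n, s n).
have sM n := matchedP (state_matched (s n)).
pose rel x y := forall n, state_left (s n) x = state_right (s n) y.
have relM x : M x -> exists2 y, N y & rel x y.
  move=> Mx; suff [y Ny yx] : exists2 y, N y & forall n,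
      state_right (s n) y = state_left (s n) x.
    by exists y => // n; rewrite yx.
  apply: match_exists => // n; first by case: (sM n).
    have [_ _ e] := sM n.
    have : (state_left (s n) @` M) (state_left (s n) x) by exists x.
    by rewrite e => -[y]; exists y.
  by move=> y Ny yx; have [r [rl rr _ _]] := sP n; rewrite -rr// yx rl.
have relN y : N y -> exists2 x, M x & rel x y.
  move=> Ny; apply: match_exists => // n; first by case: (sM n).
    have [_ _ e] := sM n.
    have : (state_right (s n) @` N) (state_right (s n) y) by exists y.
    by rewrite -e => -[x]; exists x.
  by move=> x Mx xy; have [r [rl rr _ _]] := sP n; rewrite -rl// xy rr.
have uM x x' y : M x -> M x' -> rel x y -> rel x' y -> x = x'.
  move=> Mx Mx' xy xy'; apply: mdist_eq0 => e /exists_natSinv[n ne].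
  apply: lt_trans ne; have [_ [_ _ f _]] := sP n.
  by apply: fine_lt f _ _ _ => //; rewrite xy xy'.
have uN x y y' : N y -> N y' -> rel x y -> rel x y' -> y = y'.
  move=> Ny Ny' xy xy'; apply: mdist_eq0 => e /exists_natSinv[n ne].
  apply: lt_trans ne; have [_ [_ _ _ f]] := sP n.
  by apply: fine_lt f _ _ _ => //; rewrite -xy -xy'.
have [x0 Mx0] := M0; have [y0 Ny0 _] := relM _ Mx0.
have [f fP] : {f & forall x, M x -> N (f x) /\ rel x (f x)}.
  apply: (@boolp.choice _ _ (fun x y => M x -> N y /\ rel x y)) => x.
  by have [/relM[y]|] := pselect (M x); [exists y|exists y0].
have [g gP] : {g & forall y, N y -> M (g y) /\ rel (g y) y}.
  apply: (@boolp.choice _ _ (fun y x => N y -> M x /\ rel x y)) => y.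
  by have [/relN[x]|] := pselect (N y); [exists x|exists x0].
exists f, g; split.
- move=> x Mx; have [Nf xf] := fP _ Mx; split=> //; have [? ?] := gP _ Nf.
  exact: uM xf.
- move=> y Ny; have [Mg gy] := gP _ Ny; split=> //; have [? ?] := fP _ Mg.
  exact: uN gy.
- by move=> x /fP[_ /(_ 0%N)/esym].
- move=> e /exists_natSinv[n ne]; exists (state_type (s n.+1)).
  exists (state_left (s n.+1)), (state_right (s n.+1)); split.
  + exact: state_matched.
  + by have [_ [_ _ + _]] := sP n; apply: fineW; exact: ltW.
  + by have [_ [_ _ _]] := sP n; apply: fineW; exact: ltW.
  + by move=> x /fP[_ ->].
Qed.

End back_and_forth.

(** * Uniqueness and stability of generic relations *)

Section isomorphism.
Context {R : realType}.
Implicit Types X Y : metricType R.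

Definition unif X Y (M : set X) (f : X -> Y) :=
  forall e : R, 0 < e -> exists2 d : R, 0 < d &
    forall x y, M x -> M y -> mdist x y < d -> mdist (f x) (f y) < e.

Definition uniso X Y (M : set X) (N : set Y) (f : X -> Y) (g : Y -> X) :=
  [/\ forall x, M x -> N (f x) /\ g (f x) = x,
      forall y, N y -> M (g y) /\ f (g y) = y, unif M f & unif N g].

Lemma fine_unif X Y (M : set X) (N : set Y) (f : X -> Y) :
  (forall x, M x -> N (f x)) ->
  (forall e, 0 < e -> exists (S : finType) (c : X -> S) (d : Y -> S),
     [/\ colouring M c, fine N d e & forall x, M x -> d (f x) = c x]) ->
  unif M f.
Proof.
move=> MN H e /H[S [c [d [[r r0 cr] df dc]]]]; exists r => // x y Mx My xy.
apply: fine_lt df _ _ _; [exact: MN|exact: MN|].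
by rewrite !dc//; exact: cr.
Qed.

Lemma compact_near X (M : set X) x : compact M ->
  (forall e, 0 < e -> exists2 y, M y & mdist x y < e) -> M x.
Proof.
move=> /(compact_closed (@metric_hausdorff R X)) cM xM; apply: cM => B.
move=> /nbhs_ballP[e /= e0 eB]; have [y My xy] := xM e e0; exists y; split=> //.
by apply: eB; rewrite ballEmdist.
Qed.

Lemma compact_dom X (F : set (X * X)) : compact F -> compact (dom F).
Proof.
move=> cF; apply: continuous_compact cF; apply: continuous_subspaceT => x.
exact: cvg_fst.
Qed.

(** At every scale the transition graphs coincide, so the image of a pair of [F] is arbitrarily
    close to pairs of [G], and [G] is closed. *)
Lemma fine_img X Y (F : set (X * X)) (G : set (Y * Y)) (f : X -> Y) :
  total_rel F -> total_rel G -> compact G ->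
  (forall x, dom F x -> dom G (f x)) ->
  (forall e, 0 < e -> exists (S : finType) (c : X -> S) (d : Y -> S),
     [/\ img c F = img d G, fine (dom G) d e &
         forall x, dom F x -> d (f x) = c x]) ->
  img f F `<=` G.
Proof.
move=> Ft Gt cG FG H _ [[x y] Fxy <-]; apply: compact_near => //= e e0.
have [S [c [d [cd df dc]]]] := H e e0.
have : img c F (c x, c y) by exists (x, y).
have Dx : dom F x by exists (x, y).
have Dy : dom F y by rewrite Ft; exists (x, y).
rewrite cd => -[[u v] Guv [ux vy]]; exists (u, v) => //.
have Du : dom G u by exists (u, v).
have Dv : dom G v by rewrite Gt; exists (u, v).
rewrite /mdist/= /prod_mdist/= gt_max; apply/andP; split.
  by apply: fine_lt df (FG _ Dx) Du _; rewrite dc// ux.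
by apply: fine_lt df (FG _ Dy) Dv _; rewrite dc// vy.
Qed.

Lemma img_cancel X Y (F : set (X * X)) (f : X -> Y) (g : Y -> X) :
  total_rel F -> (forall x, dom F x -> g (f x) = x) -> img g (img f F) = F.
Proof.
by move=> Ft gf; rewrite img_comp -[RHS]img_id; exact: eq_img.
Qed.

Lemma generic_uniso X Y (F : set (X * X)) (G : set (Y * Y)) :
  total_rel F -> total_rel G -> compact F -> compact G -> F !=set0 ->
  G !=set0 -> generic F -> generic G ->
  exists f g, uniso (dom F) (dom G) f g /\ img f F = G.
Proof.
move=> Ft Gt cF cG F0 G0 gF gG.
pose matched (T : finType) (a : X -> T) (b : Y -> T) :=
  [/\ colouring (dom F) a, colouring (dom G) b, img a F = img b G &
      splittable (img a F)].
(* One round refines on the first side by genericity and copies the new colours to the second by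
   [generic_extension]. Two rounds with the sides exchanged make both colourings fine. *)
have half (X1 X2 : metricType R) (F1 : set (X1 * X1)) (F2 : set (X2 * X2))
    (T : finType) (a : X1 -> T) (b : X2 -> T) e : total_rel F1 ->
    total_rel F2 -> F1 !=set0 -> F2 !=set0 -> generic F1 -> generic F2 ->
    0 < e -> colouring (dom F1) a -> colouring (dom F2) b ->
    img a F1 = img b F2 -> splittable (img a F1) ->
    exists (S : finType) (c : X1 -> S) (d : X2 -> S) (r : S -> T),
    [/\ colouring (dom F1) c, colouring (dom F2) d, img c F1 = img d F2,
      splittable (img c F1) & fine (dom F1) c e] /\
    (forall x, dom F1 x -> r (c x) = a x) /\
    (forall x, dom F2 x -> r (d x) = b x).
  move=> t1 t2 [z1 n1] n2 g1 g2 e0 ac bc ab asp; have [r r0 ar] := ac.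
  (* Fineness below [r], the constant of [a], forces [c] to refine [a]. *)
  have [S [c [cc csp cf]]] : exists (S : finType) (c : X1 -> S),
      [/\ colouring (dom F1) c, splittable (img c F1) &
        fine (dom F1) c (Num.min r e)].
    by apply: generic_fine => //; rewrite lt_min r0.
  have [||s sc] := @factor X1 S T (dom F1) a c.
  - by exists z1.1; exists z1.
  - move=> x y Mx My cxy; apply: ar => //; apply: fine_lt Mx My cxy.
    by apply: fineW cf; rewrite ge_min lexx.
  have [|||d [dc dF sd]] :=
    generic_extension (a := b) (p := s) (E := img c F1) t2 n2 g2 bc.
  - by rewrite -ab.
  - exact: img_total.
  - by rewrite img_comp -ab; exact: eq_img.
  exists S, c, d, s; split; split=> //.
  by apply: fineW cf; rewrite ge_min lexx orbT.
have dF0 : dom F !=set0 by have [z Fz] := F0; exists z.1; exists z.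
have m0 : @matched unit (fun=> tt) (fun=> tt).
  split.
  - by exists 1.
  - by exists 1.
  - have [[z Fz] [w Gw]] := (F0, G0).
    apply/seteqP; split=> _ [[x y] _ <-]; [by exists w|by exists z].
  (* The game starts from a single colour, declared right. *)
  - by exists setT; split=> [[] [] _ _|[] [] _ /(_ I)//]; split=> // -[].
have [T a b [ac bc ab _]|T a b e e0 [ac bc ab asp]|f [g [FG GF _ H]]] :=
    back_and_forth (compact_dom cF) (compact_dom cG) dF0 _ _ m0.
- by split=> //; rewrite -!img_fst ab.
- have [S [c [d [r [[cc dc cd csp cf] [rc rd]]]]]] :=
    half _ _ _ _ _ _ _ _ Ft Gt F0 G0 gF gG e0 ac bc ab asp.
  have dsp : splittable (img d G) by rewrite -cd.
  have [S' [d' [c' [r' [[dc' cc' dc'E dsp' df'] [rd' rc']]]]]] :=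
    half _ _ _ _ _ _ _ _ Gt Ft G0 F0 gG gF e0 dc cc (esym cd) dsp.
  exists S', c', d', (r \o r'); split=> //.
  + by split=> //; rewrite -dc'E.
  + by move=> x Fx /=; rewrite rc'// rc.
  + by move=> y Gy /=; rewrite rd'// rd.
  + exact: fine_comp rc' cf.
have H' e : 0 < e -> exists (S : finType) (c : Y -> S) (d : X -> S),
    [/\ matched S d c, fine (dom F) d e, fine (dom G) c e &
      forall y, dom G y -> d (g y) = c y].
  move=> /H[S [c [d [m cf df dfc]]]]; exists S, d, c; split=> // y Gy.
  by have [Fg fg] := GF _ Gy; rewrite -dfc// fg.
exists f, g; split; first split=> //.
- apply: (@fine_unif _ _ _ (dom G)); first by move=> x /FG[].
  by move=> e /H[S [c [d [[? ? ? ?] ? ? ?]]]]; exists S, c, d; split.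
- apply: (@fine_unif _ _ _ (dom F)); first by move=> x /GF[].
  by move=> e /H'[S [c [d [[? ? ? ?] ? ? ?]]]]; exists S, c, d; split.
apply/seteqP; split.
  apply: fine_img => //; first by move=> x /FG[].
  by move=> e /H[S [c [d [[? ? ? ?] ? ? ?]]]]; exists S, c, d; split.
rewrite -{1}(@img_cancel _ _ G g f Gt) => [|y /GF[]//]; apply: image_subset.
apply: fine_img => //; first by move=> x /GF[].
by move=> e /H'[S [c [d [[? ? ? ?] ? ? ?]]]]; exists S, c, d; split.
Qed.

Lemma generic_invariant X Y (F : set (X * X)) (G : set (Y * Y)) f g :
  total_rel F -> uniso (dom F) (dom G) f g -> img f F = G ->
  generic F -> generic G.
Proof.
move=> Ft [fg gf uf ug] fG gF e n e0.
have e20 : 0 < e / 2 by rewrite divr_gt0.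
have [r r0 fr] := uf _ e20.
have [J [B [b [q [bc bs bf bd]]]]] := gF r n r0.
have bgG : img (b \o g) G = img b F.
  by rewrite -fG -img_comp img_cancel// => x /fg[].
exists J, B, (b \o g), q; split.
- have [d d0 bd'] := bc; have [k k0 gk] := ug _ d0; exists k => // x y Gx Gy xy.
  by apply: bd'; [apply gf|apply gf|exact: gk].
- by rewrite -img_comp bgG img_comp.
- exists (e / 2); first by rewrite ltr_pdivrMr// ltr_pMr// ltr1n.
  move=> x y Gx Gy /= qxy; have [[Mx fx] [My fy]] := (gf _ Gx, gf _ Gy).
  by rewrite -fx -fy; apply/ltW/fr => //; exact: fine_lt bf _ _ _.
- by rewrite bgG.
Qed.

(** Hausdorff closeness by coordinates; through graphs it also covers uniform closeness of
    homeomorphisms. *)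
Definition near_rel X (d : R) (F G : set (X * X)) :=
  (forall p, F p ->
     exists2 q, G q & mdist p.1 q.1 < d /\ mdist p.2 q.2 < d) /\
  (forall q, G q ->
     exists2 p, F p & mdist p.1 q.1 < d /\ mdist p.2 q.2 < d).

(** The colouring of [F] is pulled back to [G] along a map [h] to nearby points. As [d <= r / 3],
    colours do not depend on the choice of [h] and the transition graphs agree; [d <= (e - k) / 3]
    preserves strict fineness. *)
Lemma generic_stage_open X (F : set (X * X)) (e : R) n :
  total_rel F -> generic_stage F e n ->
  exists2 d, 0 < d & forall G, total_rel G -> near_rel d F G ->
    generic_stage G e n.
Proof.
move=> Ft [J [B [b [q [[r r0 br] bs [k ke bk] bd]]]]].
pose d := Num.min (r / 3) ((e - k) / 3).
have d0 : 0 < d by rewrite lt_min !divr_gt0// subr_gt0.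
have dr : d <= r / 3 by rewrite ge_min lexx.
have dk : d <= (e - k) / 3 by rewrite ge_min lexx orbT.
move: d d0 dr dk => d d0 dr dk.
exists d => // G Gt [FG GF].
have [h hP] : {h & forall y, dom G y -> dom F (h y) /\ mdist (h y) y < d}.
  apply: (@boolp.choice _ _ (fun y x => dom G y -> dom F x /\ mdist x y < d)) => y.
  have [[p /GF[p' Fp' [p1 _]] <-]|] := pselect (dom G y); last by exists y.
  by exists p'.1; split=> //; exists p'.
have bh x y : dom F x -> dom G y -> mdist x y < d -> b (h y) = b x.
  move=> Fx Gy xy; have [Fhy hy] := hP _ Gy; apply: br => //.
  rewrite (le_lt_trans (metric_triangle _ y _))//; rewrite metric_sym in xy.
  lra.
have bhG : img (b \o h) G = img b F.
  apply/seteqP; split=> _ [[x y] Kxy <-]/=.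
    have [[u v] Fuv /= [ux vy]] := GF _ Kxy; exists (u, v) => //=.
    congr (_, _); apply/esym/bh => //; first [by exists (u, v) |
      by exists (x, y) | by rewrite Ft; exists (u, v) | by rewrite Gt; exists (x, y)].
  have [[u v] Guv /= [ux vy]] := FG _ Kxy; exists (u, v) => //=.
  congr (_, _); apply/bh => //; first [by exists (u, v) |
      by exists (x, y) | by rewrite Ft; exists (x, y) | by rewrite Gt; exists (u, v)].
exists J, B, (b \o h), q; split.
- exists (r / 3); first by rewrite divr_gt0.
  move=> x y Gx Gy xy /=; have [[Fx hx] [Fy hy]] := (hP _ Gx, hP _ Gy).
  apply: br => //; rewrite (le_lt_trans (metric_triangle _ x _))//.
  have := metric_triangle x y (h y); rewrite (metric_sym y); lra.
- by rewrite -img_comp bhG img_comp.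
- exists (k + 2 * d); first by lra.
  move=> x y Gx Gy /= qxy; have [[Fx hx] [Fy hy]] := (hP _ Gx, hP _ Gy).
  have := bk _ _ Fx Fy qxy.
  have := metric_triangle x (h x) y; rewrite (metric_sym x (h x)).
  have := metric_triangle (h x) (h y) y; lra.
- by rewrite bhG.
Qed.

End isomorphism.

(** * Compact totally disconnected metric spaces *)

Section compact_metric.
Context {R : realType} (X : metricType R).

(** Otherwise every finite subset extends by a point at distance at least [e] from it, and iterating
    gives a sequence without cluster point. *)
Lemma finite_net (M : set X) (e : R) : compact M -> 0 < e ->
  exists s : seq X, (forall p, p \in s -> M p) /\
    forall x, M x -> exists2 p, p \in s & mdist p x < e.
Proof.
move=> cM e0; apply: contrapT => nos.
have H (s : seq X) : exists x, (forall p, p \in s -> M p) ->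
    M x /\ forall p, p \in s -> e <= mdist p x.
  have [sM|nsM] := pselect (forall p, p \in s -> M p); last first.
    by apply: contrapT => nx; apply: nos; exists [::]; split=> // x Mx; exfalso;
      apply: nx; exists x.
  apply: contrapT => nx; apply: nos; exists s; split=> // x Mx.
  apply: contrapT => np; apply: nx; exists x => _; split=> // p ps.
  by rewrite leNgt; apply/negP => px; apply: np; exists p.
have [g gP] := boolp.choice H.
pose L n := iter n (fun l => g l :: l) [::].
have LM n p : p \in L n -> M p.
  elim: n p => // n IH p; rewrite inE; case/predU1P=> [->|]; last exact: IH.
  by case: (gP _ IH).
have gL m n : (m < n)%N -> g (L m) \in L n.
  elim: n => // n IH; rewrite ltnS leq_eqVlt inE; case/predU1P=> [->|/IH ->].
    by rewrite eqxx.
  by rewrite orbT.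
have [|x Mx xu] := compact_seq_cluster (u := g \o L) cM.
  by move=> n; case: (gP _ (@LM n)).
have e20 : 0 < e / 2 by rewrite divr_gt0.
have [m _ xm] := xu _ 0%N e20; have [n mn xn] := xu _ m.+1 e20.
have [_ /(_ _ (gL _ _ mn))] := gP _ (@LM n).
have := metric_triangle (g (L m)) x (g (L n)).
rewrite (metric_sym _ x); move: xm xn => /=; lra.
Qed.

Lemma compact_separated (M N : set X) : compact M -> compact N ->
  M `&` N = set0 ->
  exists2 d, 0 < d & forall x y, M x -> N y -> d <= mdist x y.
Proof.
move=> cM cN MN; apply: contrapT => nd.
have H (n : nat) : exists xy : X * X,
    [/\ M xy.1, N xy.2 & mdist xy.1 xy.2 < n.+1%:R^-1].
  apply: contrapT => nxy; apply: nd; exists n.+1%:R^-1; first by rewrite invr_gt0.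
  move=> x y Mx Ny; rewrite leNgt; apply/negP => xy.
  by apply: nxy; exists (x, y).
have [u uP] := boolp.choice H.
have [|x Mx xu] := compact_seq_cluster (u := fst \o u) cM.
  by move=> n; case: (uP n).
suff : (M `&` N) x by rewrite MN.
split=> //; apply: compact_near => // e e0.
have [n ne] := exists_natSinv (divr_gt0 e0 (ltr0n R 2)).
have [m nm xm] := xu (e / 2) n (divr_gt0 e0 (ltr0n R 2)).
have [_ Num dum] := uP m; exists (u m).2 => //.
rewrite (le_lt_trans (metric_triangle _ (u m).1 _))// [ltRHS]splitr ltrD//.
rewrite (lt_trans dum)// (le_lt_trans _ ne)// lef_pV2 ?posrE ?ltr0n//.
by rewrite ler_nat ltnS.
Qed.

(* Impredicative encoding of: x and y are joined by finitely many steps of length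
   less than e. *)
Definition chain (e : R) (x y : X) := forall A : set X, A x ->
  (forall a b, A a -> mdist a b < e -> A b) -> A y.

Lemma chain_refl e x : chain e x x. Proof. by []. Qed.

Lemma chain_trans e y x z : chain e x y -> chain e y z -> chain e x z.
Proof. by move=> xy yz A Ax AS; apply: yz => //; exact: xy. Qed.

Lemma chain_step e x y : mdist x y < e -> chain e x y.
Proof. by move=> xy A Ax AS; exact: AS xy. Qed.

Lemma chain_sym e x y : chain e x y -> chain e y x.
Proof.
move=> xy; apply: (xy [set z | chain e z x]); first exact: chain_refl.
move=> a b ax ab; apply: chain_trans ax; apply: chain_step.
by rewrite metric_sym.
Qed.

Lemma chainW e f x y : e <= f -> chain e x y -> chain f x y.
Proof.
move=> ef xy A Ax AS; apply: xy => // a b Aa ab; apply: AS Aa _.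
exact: lt_le_trans ef.
Qed.

Hypothesis cX : compact [set: X].

(** In a compact space this is the quasicomponent of [x]. It has to be shown connected, because
    total disconnectedness speaks of connected components. *)
Let Q x : set X := [set y | forall e, 0 < e -> chain e x y].

Lemma quasicomponent_cluster x (u : nat -> X) :
  (forall n, chain n.+1%:R^-1 x (u n)) ->
  exists2 y, Q x y & forall e n, 0 < e -> exists2 m, (n <= m)%N & mdist y (u m) < e.
Proof.
move=> xu; have [//|y _ yu] := compact_seq_cluster (u := u) cX; exists y => //.
move=> e e0; have [n ne] := exists_natSinv e0.
have [m nm ym] := yu e n e0; apply: (@chain_trans _ (u m)).
  apply: chainW (xu m); rewrite (le_trans _ (ltW ne))//.
  by rewrite lef_pV2 ?posrE ?ltr0n// ler_nat ltnS.
by apply: chain_step; rewrite metric_sym.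
Qed.

Lemma quasicomponent_closed x : closed (Q x).
Proof.
move=> y Qy e e0; have [z [Qz yz]] := Qy _ (nbhsx_ballx y e e0).
apply: chain_trans (Qz e e0) _; apply: chain_step.
by move: yz; rewrite metric_sym ballEmdist.
Qed.

(** A chain from [x] to a point of [B] with steps below [d / 3] must leave the [d / 3]-neighbourhood
    of [A], and where it leaves, it is still [d / 3] away from [B]. As the steps shrink, these exit
    points accumulate at a point of [Q x] outside [A] and [B]. *)
Lemma quasicomponent_split x (A B : set X) : compact A -> compact B ->
  A `&` B = set0 -> Q x = A `|` B -> A x -> B = set0.
Proof.
move=> cA cB AB QAB Ax; apply/seteqP; split=> // y By; exfalso.
have [d d0 dAB] := compact_separated cA cB AB.
have d30 : 0 < d / 3 by rewrite divr_gt0.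
have H (n : nat) : exists b, chain n.+1%:R^-1 x b /\
    forall z, Q x z -> d / 3 <= mdist z b.
  pose e := Num.min n.+1%:R^-1 (d / 3).
  have e0 : 0 < e by rewrite lt_min invr_gt0 ltr0n.
  have en : e <= n.+1%:R^-1 by rewrite ge_min lexx.
  have ed : e <= d / 3 by rewrite ge_min lexx orbT.
  have xy : chain e x y by have : Q x y by [rewrite QAB; right]; exact.
  apply: contrapT => nb.
  have [_ [p Ap py]] : [set z | chain e x z /\
      exists2 p, A p & mdist p z < d / 3] y.
    apply: xy; first by split=> //; exists x => //; rewrite mdistxx.
    move=> a b [xa [p Ap pa]] ab.
    have xb : chain e x b by apply: chain_trans xa _; exact: chain_step.
    split=> //; apply: contrapT => npb; apply: nb; exists b; split.
      exact: chainW xb.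
    move=> z; rewrite QAB => -[Az|Bz].
      by rewrite leNgt; apply/negP => zb; apply: npb; exists z.
    have := dAB _ _ Ap Bz; have := metric_triangle p a z.
    have := metric_triangle a b z; rewrite (metric_sym b z); lra.
  have := dAB _ _ Ap By; lra.
have [b bP] := boolp.choice H.
have [|z Qz zb] := @quasicomponent_cluster x b; first by move=> n; case: (bP n).
have [m _] := zb _ 0%N d30; have [_ /(_ _ Qz)] := bP m; rewrite leNgt.
by move=> /negP.
Qed.

Lemma quasicomponent_connected x : connected (Q x).
Proof.
move=> B B0 [C oC BC] [C' cC' BC'].
have cB : compact B.
  apply: (subclosed_compact _ cX) => //; rewrite BC'; apply: closedI => //.
  exact: quasicomponent_closed.
have cD : compact (Q x `\` B).
  apply: (subclosed_compact _ cX) => //; rewrite (_ : _ `\` _ = Q x `&` ~` C).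
    by apply: closedI; [exact: quasicomponent_closed|exact: open_closedC].
  rewrite BC; apply/seteqP; split=> y [Qy nC]; split=> // Cy; apply: nC => //.
  by case: Cy.
have BQ : B `<=` Q x by rewrite BC => y [].
have QBD : Q x = B `|` (Q x `\` B) by rewrite setDUK.
have BD : B `&` (Q x `\` B) = set0 by rewrite setDE setICA setICr setI0.
have [Bx|nBx] := pselect (B x).
  have D0 := quasicomponent_split cB cD BD QBD Bx.
  by rewrite QBD D0 setU0.
have := @quasicomponent_split x _ _ cD cB; rewrite setIC setUC.
move=> /(_ BD QBD); have [z Bz] := B0; move=> B00.
by have : set0 z by rewrite -B00//; split=> // e e0; exact: chain_refl.
Qed.

(** Counterexamples for ever smaller steps would cluster at some [(x, y)] with [y] in the connected
    set [Q x], forcing [x = y], although their distances stay at least [e]. *)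
Lemma chain_small (e : R) : totally_disconnected [set: X] -> 0 < e ->
  exists2 d, 0 < d & forall x y, chain d x y -> mdist x y < e.
Proof.
move=> dX e0; apply: contrapT => nd.
have H (n : nat) : exists xy : X * X, chain n.+1%:R^-1 xy.1 xy.2 /\
    e <= mdist xy.1 xy.2.
  apply: contrapT => nxy; apply: nd; exists n.+1%:R^-1; first by rewrite invr_gt0.
  move=> x y xy; rewrite ltNge; apply/negP => exy.
  by apply: nxy; exists (x, y).
have [u uP] := boolp.choice H.
have cXX : compact [set: X * X].
  by rewrite -setXTT; exact: compact_setX.
have [//|[x y] _ xyu] := compact_seq_cluster (u := u) cXX.
have near d n : 0 < d -> exists m, [/\ (n <= m)%N, mdist x (u m).1 < d &
    mdist y (u m).2 < d].
  move=> d0; have [m nm] := xyu d n d0.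
  by rewrite /mdist/= /prod_mdist gt_max/= => /andP[? ?]; exists m.
have Qxy : Q x y.
  move=> d d0; have [n nd'] := exists_natSinv d0.
  have [m [nm xm ym]] := near d n d0; have [xym _] := uP m.
  apply: (@chain_trans _ (u m).1); first exact: chain_step.
  apply: (@chain_trans _ (u m).2); last by apply: chain_step; rewrite metric_sym.
  apply: chainW xym; rewrite (le_trans _ (ltW nd'))//.
  by rewrite lef_pV2 ?posrE ?ltr0n// ler_nat ltnS.
have xy : y = x.
  have : connected_component [set: X] x y.
    exists (Q x) => //; split=> //; last exact: quasicomponent_connected.
    by move=> d _; exact: chain_refl.
  by rewrite dX.
have [m [_ xm ym]] := near (e / 2) 0%N (divr_gt0 e0 (ltr0n R 2)).
have [_] := uP m; have := metric_triangle (u m).1 x (u m).2.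
by rewrite (metric_sym _ x) -{2}xy; lra.
Qed.

Lemma totally_disconnected_fine (e : R) :
  totally_disconnected [set: X] -> 0 < e ->
  exists (T : finType) (k : X -> T), colouring [set: X] k /\ fine [set: X] k e.
Proof.
move=> dX e0; have [d d0 de] := chain_small dX (divr_gt0 e0 (ltr0n R 2)).
have [s [_ sP]] := finite_net cX d0.
(* The colour names the first net point chained to [x]; the net provides one, so [find] never
   returns [size s]. *)
pose k x : 'I_(size s).+1 := inord (find (fun p => `[< chain d p x >]) s).
have ks x y : chain d x y -> k x = k y.
  move=> xy; congr (inord _); apply: eq_find => p; apply/asbool_equiv_eq; split.
    by move=> px; exact: chain_trans px xy.
  by move=> py; apply: chain_trans py _; exact: chain_sym.
have ch x : chain d (nth x s (k x)) x /\ (k x < size s)%N.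
  have hs : has (fun p => `[< chain d p x >]) s.
    apply/hasP; have [//|p ps px] := sP x.
    by exists p => //; apply/asboolP; exact: chain_step.
  have := nth_find x hs => /asboolP; rewrite /k inordK ?ltnS ?find_size//.
  by rewrite -has_find hs.
exists ('I_(size s).+1 : finType), k; split.
  by exists d => // x y _ _ xy; apply: ks; exact: chain_step.
exists (e / 2); first by lra.
move=> x y _ _ kxy; apply/ltW/de.
have [cx lx] := ch x; have [cy ly] := ch y.
apply: chain_trans (chain_sym cx) _; rewrite kxy (set_nth_default y)//.
Qed.

End compact_metric.

(** * Homeomorphisms of Cantor spaces *)

Section homeomorphisms.
Context {R : realType}.
Implicit Types X Y K : metricType R.

Lemma unif_continuous X Y (f : X -> Y) : unif [set: X] f -> continuous f.
Proof.
move=> uf x; apply/metricType_numDomainType.cvgrPdist_lt => e e0; have [d d0 fd] := uf e e0.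
by apply/nbhs_ballP; exists d => //= y; rewrite ballEmdist => xy; exact: fd.
Qed.

Lemma continuous_unif X Y (f : X -> Y) :
  compact [set: X] -> continuous f -> unif [set: X] f.
Proof.
move=> cX cf e e0; apply: contrapT => nd.
have H (n : nat) : exists xy : X * X, mdist xy.1 xy.2 < n.+1%:R^-1 /\
    e <= mdist (f xy.1) (f xy.2).
  apply: contrapT => nxy; apply: nd; exists n.+1%:R^-1; first by rewrite invr_gt0.
  move=> x y _ _ xy; rewrite ltNge; apply/negP => exy.
  by apply: nxy; exists (x, y).
have [u uP] := boolp.choice H.
have [//|x _ xu] := compact_seq_cluster (u := fst \o u) cX.
have e20 : 0 < e / 2 by rewrite divr_gt0.
have : nbhs x [set y | mdist (f x) (f y) < e / 2].
  exact: (iffLR (metricType_numDomainType.cvgrPdist_lt _ _) (cf x)).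
move=> /nbhs_ballP[d /= d0 xd].
have d20 : 0 < d / 2 by rewrite divr_gt0.
have [n nd2] := exists_natSinv d20; have [m nm xm] := xu _ n d20.
have [um fum] := uP m.
have nm' : m.+1%:R^-1 <= n.+1%:R^-1 :> R.
  by rewrite lef_pV2 ?posrE ?ltr0n// ler_nat ltnS.
have h1 : mdist (f x) (f (u m).1) < e / 2.
  by apply: xd; rewrite ballEmdist/=; move: xm => /=; lra.
have h2 : mdist (f x) (f (u m).2) < e / 2.
  apply: xd; rewrite ballEmdist/=; move: xm => /=.
  have := metric_triangle x (u m).1 (u m).2.
  have := lt_trans (lt_le_trans um nm') nd2; lra.
have := metric_triangle (f (u m).1) (f x) (f (u m).2).
rewrite (metric_sym _ (f x)); move: fum h1 h2; rewrite /=; lra.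
Qed.

Lemma uniso_homeomorphism X Y (f : X -> Y) g :
  uniso [set: X] [set: Y] f g -> homeomorphism f.
Proof.
move=> [fg gf uf ug]; split; first exact: unif_continuous.
exists g; split; [by move=> x; case: (fg x)|by move=> y; case: (gf y)|].
exact: unif_continuous.
Qed.

Lemma homeomorphism_uniso X Y (f : X -> Y) : compact [set: X] ->
  homeomorphism f -> exists g, uniso [set: X] [set: Y] f g.
Proof.
move=> cX [cf [g [fg gf cg]]]; exists g.
have cY : compact [set: Y].
  rewrite (_ : setT = f @` setT).
    by apply: continuous_compact cX; exact: continuous_subspaceT.
  by apply/seteqP; split=> // y _; exists (g y).
by split=> //; exact: continuous_unif.
Qed.

Definition graph X (h : X -> X) : set (X * X) := [set (x, h x) | x in [set: X]].

Lemma dom_graph X (h : X -> X) : dom (graph h) = [set: X].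
Proof. by rewrite /graph image_comp image_id. Qed.

Lemma graph_total X (h : X -> X) : homeomorphism h -> total_rel (graph h).
Proof.
move=> [_ [g [_ gh _]]]; rewrite /total_rel dom_graph.
by apply/seteqP; split=> // y _; exists (g y, y) => //; exists (g y); rewrite ?gh.
Qed.

Lemma graph_compact X (h : X -> X) :
  compact [set: X] -> continuous h -> compact (graph h).
Proof.
move=> cX ch; apply: continuous_compact cX; apply: continuous_subspaceT => x.
by apply: cvg_pair => //; exact: ch.
Qed.

Lemma graph_nonempty X (h : X -> X) : [set: X] !=set0 -> graph h !=set0.
Proof. by move=> [x _]; exists (x, h x); exists x. Qed.

(** An equivalent of [cantor_metric_space] in which total disconnectedness takes the form of a
    supply of fine colourings. *)
Definition cantorian K := [/\ compact [set: K], [set: K] !=set0,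
  (forall (x : K) (e : R), 0 < e -> exists2 y, y != x & mdist x y < e) &
  forall e : R, 0 < e -> exists (T : finType) (k : K -> T),
    colouring [set: K] k /\ fine [set: K] k e].

Lemma cantor_cantorian K : cantor_metric_space K -> cantorian K.
Proof.
move=> [K0 cK [_ pK] dK]; split=> //.
  move=> x e e0; have : limit_point [set: K] x by rewrite pK.
  move=> /(_ _ (nbhsx_ballx x e e0))[y [yx _ xy]]; exists y => //.
  by move: xy; rewrite ballEmdist.
by move=> e; exact: totally_disconnected_fine.
Qed.

Section splitting.
Variables (K : metricType R) (cK : cantorian K).

(** By induction on the size of [C]: drop one of two colours with the same image under [r], realize
    the others, then cut the class of its twin in two. Perfectness provides two points in that
    class. *)
Lemma split_colouring (B S : finType) (a : K -> B) (r : S -> B) (C : set S) :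
  colouring [set: K] a -> a @` [set: K] = r @` C ->
  exists c : K -> S, [/\ colouring [set: K] c, c @` [set: K] = C &
    forall x, r (c x) = a x].
Proof.
move=> ac; have -> : C = [set s | s \in [set s | `[<C s>]]%SET].
  by apply/seteqP; split=> s /=; rewrite inE => /asboolP.
move: [set s | `[<C s>]]%SET => {}C.
elim: {C}#|C| {-2}C (erefl #|C|) => [|n IH] C Cn aC.
  have [_ [x _] _ _] := cK; have : (a @` setT) (a x) by exists x.
  by rewrite aC (cards0_eq Cn) => -[s]; rewrite /= inE.
have [inj|ninj] := pselect (forall s t, s \in C -> t \in C -> r s = r t -> s = t).
  have H x : exists s, s \in C /\ r s = a x.
    have : (a @` setT) (a x) by exists x.
    by rewrite aC => -[s]; exists s.
  have [c cP] := boolp.choice H; exists c; split.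
  - have [d d0 ad] := ac; exists d => // x y _ _ xy.
    have [[? rx] [? ry]] := (cP x, cP y).
    by apply: inj => //; rewrite rx ry; exact: ad.
  - apply/seteqP; split=> [_ [x _ <-]|s sC]; first by case: (cP x).
    have : (r @` [set s | s \in C]) (r s) by exists s.
    rewrite -aC => -[x _ ax]; exists x => //; have [? rx] := cP x.
    by apply: inj => //; rewrite rx.
  - by move=> x; case: (cP x).
have [s [t [sC tC rst st]]] : exists s t, [/\ s \in C, t \in C, r s = r t & s <> t].
  apply: contrapT => nst; apply: ninj => s t sC tC rst; apply: contrapT => st.
  by apply: nst; exists s, t.
have st' : s != t by exact/eqP.
have [||c [cc cC rc]] := IH (C :\ t).
- by have := cardsD1 t C; rewrite tC Cn => -[].
- rewrite aC; apply/seteqP; split=> _ [u /= uC <-].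
    have [->|ut] := eqVneq u t; last by exists u => //=; rewrite !inE ut.
    by exists s => //=; rewrite !inE st'.
  by exists u => //=; move: uC; rewrite !inE => /andP[].
have [x _ cx] : (c @` setT) s by rewrite cC /= !inE st'.
(* Being within the constant of [c], [x] and [y] both have colour [s]; a finer colouring [k]
   separates them. *)
have [_ _ pK fK] := cK; have [d d0 cd] := cc; have [y yx xy] := pK x d d0.
have [T [k [kc kf]]] := fK (mdist x y) (ltac:(by rewrite mdist_gt0 eq_sym)).
pose c' z := if (c z == s) && (k z == k y) then t else c z.
exists c'; split.
- exact: (colouring_comp (fun w : S * T => if (w.1 == s) && (w.2 == k y) then t
    else w.1) (colouring_prod cc kc)).
- apply/seteqP; split=> [_ [z _ <-]|u /= uC]; rewrite /c' /=.
    case: ifP => // _; have : (c @` setT) (c z) by exists z.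
    by rewrite cC /= !inE => /andP[].
  have [->|ut] := eqVneq u t.
    by exists y => //; rewrite -(cd x y)// cx !eqxx.
  have [->|us] := eqVneq u s.
    exists x => //; rewrite cx eqxx/=; case: eqP => // kxy.
    by have := fine_lt kf I I kxy; rewrite ltxx.
  have [z _ cz] : (c @` setT) u by rewrite cC /= !inE ut.
  by exists z => //; rewrite cz (negbTE us).
- by move=> z; rewrite /c' -rc; case: ifP => // /andP[/eqP -> _].
Qed.

End splitting.

(** A back-and-forth in which only the sets of attained colours are matched: by [split_colouring]
    any refinement on one side can be copied to the other. *)
Lemma fibre_homeo X Y (T : finType) (a : X -> T) (b : Y -> T) :
  cantorian X -> cantorian Y -> colouring [set: X] a -> colouring [set: Y] b ->
  a @` [set: X] = b @` [set: Y] ->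
  exists2 f, homeomorphism f & forall x, b (f x) = a x.
Proof.
move=> CX CY ac bc ab; have [[cX X0 _ _] [cY _ _ _]] := (CX, CY).
pose matched (T : finType) (a : X -> T) (b : Y -> T) :=
  [/\ colouring [set: X] a, colouring [set: Y] b & a @` [set: X] = b @` [set: Y]].
have half (X1 X2 : metricType R) (S : finType) (p : X1 -> S) (q : X2 -> S)
    (e : R) : cantorian X1 -> cantorian X2 -> 0 < e -> colouring [set: X1] p ->
    colouring [set: X2] q -> p @` [set: X1] = q @` [set: X2] ->
    exists (S' : finType) (c : X1 -> S') (d : X2 -> S') (r : S' -> S),
    [/\ colouring [set: X1] c, colouring [set: X2] d,
        c @` [set: X1] = d @` [set: X2] & fine [set: X1] c e] /\
    (forall x, r (c x) = p x) /\ (forall x, r (d x) = q x).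
  move=> C1 C2 e0 pc qc pq; have [_ _ _ /(_ e e0)[U [k [kc kf]]]] := C1.
  pose c x := (p x, k x).
  have cc : colouring [set: X1] c by exact: colouring_prod.
  have [|d [dc dC dr]] :=
      split_colouring C2 (r := @fst S U) (C := c @` [set: X1]) qc.
    by rewrite image_comp -pq.
  exists (S * U)%type, c, d, fst; split; split=> //.
  exact: (fine_comp (r := snd)) kf.
have [//|S p q e e0 [pc qc pq]|f [g [FG GF bf H]]] :=
    @back_and_forth R X Y setT setT matched cX cY X0 _ _ T a b (And3 ac bc ab).
  have [S' [c [d [r [[cc dc cd cf] [rc rd]]]]]] := half _ _ _ _ _ _ CX CY e0 pc qc pq.
  have [S2 [d' [c' [r' [[dc' cc' dc'E df'] [rd' rc']]]]]] :=
    half _ _ _ _ _ _ CY CX e0 dc cc (esym cd).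
  exists S2, c', d', (r \o r'); split=> //.
  - by move=> x _ /=; rewrite rc' rc.
  - by move=> x _ /=; rewrite rd' rd.
  - by apply: (fine_comp (r := r')) cf.
exists f; last by move=> x; exact: bf.
apply: (@uniso_homeomorphism _ _ _ g); split=> //.
  apply: (@fine_unif _ _ _ _ setT) => // e /H[S [c [d [[? ? ?] ? ? ?]]]].
  by exists S, c, d; split.
apply: (@fine_unif _ _ _ _ setT) => // e /H[S [c [d [[? ? ?] ? ? dfc]]]].
exists S, d, c; split=> // y _; have [_ fg] := GF y I.
by rewrite -dfc// fg.
Qed.

Section realization.
Variables (K : metricType R) (cK : cantorian K).

(** Colour [K] twice by the edges of [E], by [o] over their sources and by [i] over their targets. A
    homeomorphism carrying [o] to [i] moves every point along the edge that colours it, and every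
    edge is used. *)
Lemma realize_colouring (J : finType) (c : K -> J) (E : set (J * J)) :
  colouring [set: K] c -> total_rel E -> c @` [set: K] = dom E ->
  exists2 h : K -> K, homeomorphism h & img c (graph h) = E.
Proof.
move=> cc Et cE.
have [//|o [oc oE fo]] := split_colouring cK (r := @fst J J) (C := E) cc.
have [|i [ic iE si]] := split_colouring cK (r := @snd J J) (C := E) cc.
  by rewrite cE.
have [h hh ih] := fibre_homeo cK cK oc ic (etrans oE (esym iE)).
exists h => //; rewrite -oE /img/graph image_comp.
by apply: eq_imagel => x _ /=; rewrite -fo -si ih; case: (o x).
Qed.

Lemma realize (A J : finType) (a : K -> A) (h0 : K -> K) (E : set (J * J))
    (r : J -> A) : colouring [set: K] a -> total_rel E ->
  img r E = img a (graph h0) ->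
  exists (h : K -> K) (c : K -> J), [/\ homeomorphism h, colouring [set: K] c,
    img c (graph h) = E & forall x, r (c x) = a x].
Proof.
move=> ac Et rE.
have [|c [cc cE rc]] := split_colouring cK (r := r) (C := dom E) ac.
  by rewrite -(dom_graph h0) -img_fst -rE img_fst.
have [h hh hE] := realize_colouring cc Et cE.
by exists h, c.
Qed.

(** The transition graph of [h0] gets a splittable cover, this one a dominating cover, and the
    latter is realized by [h]. Up to colours of [a], every step of [h] is a step of [h0], whence the
    closeness. *)
Lemma generic_stage_dense (h0 : K -> K) e n e' :
  homeomorphism h0 -> 0 < e -> 0 < e' -> exists h : K -> K,
  [/\ homeomorphism h, generic_stage (graph h) e n &
      forall x, mdist (h0 x) (h x) < e'].
Proof.
move=> hh e0 e'0; have [cT _ _ fK] := cK.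
have [d d0 hd] : exists2 d, 0 < d & forall x y, mdist x y < d ->
    mdist (h0 x) (h0 y) < e' / 2.
  have [d d0 hd] := continuous_unif cT hh.1 (divr_gt0 e'0 (ltr0n R 2)).
  by exists d => // x y; exact: hd.
(* Fineness below [d] and [e' / 2] bounds the two halves of the way from [h0 x] to [h x] through
   [h0 z], where [z] has the colour of [x]. *)
pose f := Num.min e (Num.min d (e' / 2)).
have f0 : 0 < f by rewrite !lt_min e0 d0 divr_gt0.
have [A [a [ac af]]] := fK f f0.
have [D [Dt Ds DA]] := splittable_cover (img_total a (graph_total hh)).
have [J [F [q [Ft qF dF]]]] := dominating_cover n Dt Ds.
have [|h [c [hom cc cF qc]]] := realize (r := fst \o q) (h0 := h0) ac Ft.
  by rewrite -img_comp qF.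
exists h; split=> //.
  exists J, (A * bool)%type, c, q; rewrite dom_graph; split=> //.
  - by rewrite -img_comp cF qF.
  - apply: (fine_comp (r := fst)) (fineW _ af); last by rewrite /f ge_min lexx.
    by move=> x _; exact: qc.
  - by rewrite cF.
move=> x; have : img a (graph h0) (a x, a (h x)).
  rewrite -DA -qF -cF !img_comp; exists (x, h x); first by exists x.
  by congr (_, _); exact: qc.
move=> [_ [z _ <-] /= [az ahz]].
have zx : mdist z x < d.
  by rewrite (lt_le_trans (fine_lt af _ _ az))// /f !ge_min lexx orbT.
have hz : mdist (h0 z) (h x) < e' / 2.
  by rewrite (lt_le_trans (fine_lt af _ _ ahz))// /f !ge_min lexx !orbT.
have := metric_triangle (h0 x) (h0 z) (h x); have := hd _ _ zx.
by rewrite (metric_sym (h0 z) (h0 x)); lra.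
Qed.

End realization.
End homeomorphisms.

(** * The Baire property of the homeomorphism group *)

Section homeo_baire.
Context {R : realType} (K : metricType R).
Hypothesis cK : compact [set: K].
Implicit Types (h k : K -> K) (U : set (K -> K)).

Definition homeo_open U := forall h, homeomorphism h -> U h ->
  exists2 e : R, 0 < e & forall k, homeomorphism k ->
    (forall x, mdist (h x) (k x) < e) -> U k.

Definition homeo_dense U := forall h (e : R), homeomorphism h -> 0 < e ->
  exists k, [/\ homeomorphism k, U k & forall x, mdist (h x) (k x) < e].

(* A map within [t.2] of [t.1] moves points at distance at least [1/(n+1)] to
   distinct points: this keeps the limit injective. *)
Let step (n : nat) U (s t : (K -> K) * R) :=
  [/\ homeomorphism t.1, 0 < t.2, t.2 <= s.2 / 2 & t.2 <= n.+1%:R^-1] /\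
  [/\ forall x, mdist (s.1 x) (t.1 x) < s.2 / 2,
      forall k, homeomorphism k -> (forall x, mdist (t.1 x) (k x) <= t.2) -> U k &
      forall x y, mdist (t.1 x) (t.1 y) < 3 * t.2 -> mdist x y < n.+1%:R^-1].

Let step_ex n U s : homeo_open U -> homeo_dense U -> homeomorphism s.1 ->
  0 < s.2 -> exists t, step n U s t.
Proof.
move=> oU dU hs s0; have s20 : 0 < s.2 / 2 by rewrite divr_gt0.
have n0 : 0 < n.+1%:R^-1 :> R by rewrite invr_gt0.
have [k [hk Uk sk]] := dU _ _ hs s20; have [e e0 ke] := oU k hk Uk.
have [g [kg gk uk ug]] := homeomorphism_uniso cK hk.
have [d d0 gd] := ug _ n0.
(* In order: geometric decay, radii tending to 0, a closed ball inside [U], and separation of points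
   at distance at least [1/(n+1)]. *)
pose r := Num.min (s.2 / 2) (Num.min n.+1%:R^-1 (Num.min (e / 2) (d / 3))).
have r0 : 0 < r by rewrite !lt_min s20 n0 !divr_gt0.
have rd : 3 * r <= d.
  have : r <= d / 3 by rewrite /r !ge_min lexx !orbT.
  by rewrite ler_pdivlMr// mulrC.
exists (k, r); split; split=> //=.
- by rewrite /r ge_min lexx.
- by rewrite /r !ge_min lexx orbT.
- move=> k' hk' kk'; apply: ke => // x; rewrite (le_lt_trans (kk' x))//.
  rewrite (@le_lt_trans _ _ (e / 2))//; last by lra.
  by rewrite /r !ge_min lexx !orbT.
- move=> x y xy; have [_ gx] := kg x I; have [_ gy] := kg y I.
  by rewrite -gx -gy; apply: gd => //; exact: lt_le_trans rd.
Qed.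

(** In [3 * r n.+1], two terms pay for replacing [h n.+1] by [k] at both points; the third remains
    as a modulus of continuity for the inverse of [k]. Surjectivity comes from a cluster point of
    preimages under the [h n]. *)
Let limit (h : nat -> K -> K) (r : nat -> R) : (forall n, homeomorphism (h n)) ->
  (forall n, 0 < r n) -> (forall n, r n.+1 <= r n / 2) ->
  (forall n, r n.+1 <= n.+1%:R^-1) ->
  (forall n x, mdist (h n x) (h n.+1 x) < r n / 2) ->
  (forall n x y, mdist (h n.+1 x) (h n.+1 y) < 3 * r n.+1 ->
    mdist x y < n.+1%:R^-1) ->
  exists2 k, homeomorphism k & forall n x, mdist (h n x) (k x) <= r n.
Proof.
move=> hh r0 rS rn hS hm.
have hnm n m x : (n <= m)%N -> mdist (h n x) (h m x) <= r n - r m.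
  elim: m => [|m IH]; first by rewrite leqn0 => /eqP ->; rewrite mdistxx subrr.
  rewrite leq_eqVlt; case/predU1P=> [->|/IH nm]; first by rewrite mdistxx subrr.
  have := metric_triangle (h n x) (h m x) (h m.+1 x).
  have := hS m x; have := rS m; lra.
have [k kP] : {k & forall x (e : R) n, 0 < e ->
    exists2 m, (n <= m)%N & mdist (k x) (h m x) < e}.
  apply: (@boolp.choice _ _ (fun x y => forall (e : R) n, 0 < e ->
    exists2 m, (n <= m)%N & mdist y (h m x) < e)) => x.
  by have [//|y _ yx] := compact_seq_cluster (u := h^~ x) cK; exists y.
have hk n x : mdist (h n x) (k x) <= r n.
  apply/ler_addgt0Pl => e e0; have [m nm km] := kP x e n e0.
  have := hnm n m x nm; have := metric_triangle (h n x) (h m x) (k x).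
  rewrite (metric_sym (h m x)); have := r0 m; lra.
have small (e : R) : 0 < e -> exists n, r n.+1 < e.
  by move=> /exists_natSinv[n ne]; exists n; exact: le_lt_trans ne.
exists k => //.
have uk : unif [set: K] k.
  move=> e e0; have e30 : 0 < e / 3 by rewrite divr_gt0.
  have [n rne] := small _ e30.
  have [d d0 hd] := continuous_unif cK (hh n.+1).1 e30.
  exists d => // x y _ _ xy; have := hd _ _ I I xy.
  have := hk n.+1 x; have := hk n.+1 y.
  have := metric_triangle (k x) (h n.+1 x) (k y).
  have := metric_triangle (h n.+1 x) (h n.+1 y) (k y).
  rewrite (metric_sym (k x) (h n.+1 x)); lra.
have km n x y : mdist (k x) (k y) < r n.+1 -> mdist x y < n.+1%:R^-1.
  move=> kxy; apply: hm; have := hk n.+1 x; have := hk n.+1 y.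
  have := metric_triangle (h n.+1 x) (k x) (h n.+1 y).
  have := metric_triangle (k x) (k y) (h n.+1 y).
  rewrite (metric_sym (k y) (h n.+1 y)); lra.
have kinj x y : k x = k y -> x = y.
  move=> kxy; apply: mdist_eq0 => e /exists_natSinv[n ne].
  by apply: lt_trans ne; apply: km; rewrite kxy mdistxx.
have ksurj y : exists x, k x = y.
  have hx n : exists x, h n x = y.
    by have [_ [g [_ gh _]]] := hh n; exists (g y); rewrite gh.
  have [u uy] := boolp.choice hx.
  have [//|x _ xu] := compact_seq_cluster (u := u) cK; exists x.
  apply: mdist_eq0 => e e0; have e20 : 0 < e / 2 by rewrite divr_gt0.
  have [d d0 kd] := uk _ e20; have [n rne] := small _ e20.
  have [m nm xm] := xu d n.+1 d0; have := kd _ _ I I xm.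
  have rnm : r m <= r n.+1.
    by have := hnm n.+1 m x nm; have := mdist_ge0 (h n.+1 x) (h m x); lra.
  have := hk m (u m); rewrite uy; have := metric_triangle (k x) (k (u m)) y.
  by rewrite (metric_sym y (k (u m))); lra.
have [g gP] := boolp.choice ksurj.
apply: (@uniso_homeomorphism _ _ _ _ g); split=> //.
  by move=> x; split=> //; apply: kinj; rewrite gP.
move=> e /exists_natSinv[n ne]; exists (r n.+1) => // x y _ _ xy.
by apply: lt_trans ne; apply: km; rewrite !gP.
Qed.

Theorem homeo_baire (U : nat -> set (K -> K)) :
  (forall n, homeo_open (U n)) -> (forall n, homeo_dense (U n)) ->
  homeo_dense (\bigcap_n U n).
Proof.
move=> oU dU h e hh e0.
have [f fP] : {f & forall ns : nat * ((K -> K) * R), homeomorphism ns.2.1 ->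
    0 < ns.2.2 -> step ns.1 (U ns.1) ns.2 (f ns)}.
  apply: (@boolp.choice _ _ (fun ns t => homeomorphism ns.2.1 -> 0 < ns.2.2 ->
    step ns.1 (U ns.1) ns.2 t)) => -[n s] /=.
  have [[hs s0]|ns] := pselect (homeomorphism s.1 /\ 0 < s.2).
    by have [t st] := step_ex n (oU n) (dU n) hs s0; exists t.
  by exists s => hs s0; exfalso; exact: ns.
pose s := fix s n := if n is m.+1 then f (m, s m) else (h, e / 2).
have sP n : homeomorphism (s n).1 /\ 0 < (s n).2.
  elim: n => [|n [hn rn]]; first by split=> //=; rewrite divr_gt0.
  by have [[]] := fP (n, s n) hn rn.
have sS n : step n (U n) (s n) (s n.+1).
  by have [hn rn] := sP n; exact: fP (n, s n) hn rn.
have [||||||k hk sk] := @limit (fun n => (s n).1) (fun n => (s n).2).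
- by move=> n; case: (sP n).
- by move=> n; case: (sP n).
- by move=> n; case: (sS n) => -[].
- by move=> n; case: (sS n) => -[].
- by move=> n; case: (sS n) => _ [].
- by move=> n; case: (sS n) => _ [].
exists k; split=> // [n _|x].
  by have [_ [_ + _]] := sS n; apply.
by apply: le_lt_trans (sk 0%N x) _; rewrite /=; lra.
Qed.

End homeo_baire.

(** * The Special Homeomorphism *)

Section generic_index.
Context {R : realType} (X : metricType R).

(** A G_delta set needs countably many conditions: radii [1/(i+1)] and bounds [j], coded by one
    number. *)
Definition generic_index (F : set (X * X)) (n : nat) :=
  if @unpickle (nat * nat)%type n is Some (i, j)
  then generic_stage F i.+1%:R^-1 j else True.

Lemma generic_stageW (F : set (X * X)) (e f : R) n :
  e <= f -> generic_stage F e n -> generic_stage F f n.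
Proof.
by move=> ef [J [B [b [q [? ? bf ?]]]]]; exists J, B, b, q; split=> //; exact: fineW bf.
Qed.

Lemma genericP (F : set (X * X)) : generic F <-> forall n, generic_index F n.
Proof.
split=> [gF n|gF e n e0].
  rewrite /generic_index; case: unpickle => // -[i j].
  by apply: gF; rewrite invr_gt0.
have [i ie] := exists_natSinv e0; have := gF (pickle (i, n)).
by rewrite /generic_index pickleK; apply: generic_stageW; exact: ltW.
Qed.

Lemma generic_index_open (F : set (X * X)) n :
  total_rel F -> generic_index F n ->
  exists2 d : R, 0 < d & forall G, total_rel G -> near_rel d F G ->
    generic_index G n.
Proof.
rewrite /generic_index; case: unpickle => [[i j]|].
  exact: generic_stage_open.
by move=> _ _; exists 1.
Qed.

End generic_index.

Section homeo_group_topology.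
Context {R : realType} (K : metricType R).
Implicit Types (P : set (K -> K)) (A : set (homeo_group K)).

Definition homeo_elt (h : K -> K) (hh : homeomorphism h) : homeo_group K :=
  exist _ (h : {uniform K -> K}) (mem_set hh).

Lemma homeo_eltP (t : homeo_group K) : homeomorphism (set_val t : K -> K).
Proof. by have /set_mem := valP t; rewrite set_valE. Qed.

Lemma homeo_nbhs (t : homeo_group K) A : nbhs t A <->
  exists2 e : R, 0 < e & forall s : homeo_group K,
    (forall x, mdist ((set_val t : K -> K) x) ((set_val s : K -> K) x) < e) -> A s.
Proof.
split=> [|[e e0 eA]].
  rewrite nbhsE => -[_ [[W oW <-] Wt] WA].
  have : nbhs (set_val t : {uniform K -> K}) W by exact: open_nbhs_nbhs.
  move=> /uniform_nbhs[E [+ EW]]; rewrite -entourage_from_ballE => -[e /= e0 eE].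
  exists e => // s ts; apply: WA; apply: EW => x _; apply: eE => /=.
  by rewrite ballEmdist; exact: ts.
have : nbhs (set_val t : {uniform K -> K}) [set h : {uniform K -> K} |
    forall x, mdist ((set_val t : K -> K) x) ((h : K -> K) x) < e].
  apply/uniform_nbhs; exists [set xy : K * K | ball xy.1 e xy.2]; split.
    by rewrite -entourage_from_ballE; exists e.
  by move=> h /= th x; have := th x I; rewrite ballEmdist.
have vc : continuous (set_val : homeo_group K -> {uniform K -> K}).
  exact: initial_continuous.
move=> /(vc t) N; apply: (@filterS _ (nbhs t) _ _ _ _ N) => s; exact: eA.
Qed.

Lemma homeo_open_open P : homeo_open P ->
  open [set t : homeo_group K | P (set_val t)].
Proof.
move=> oP; rewrite openE => t Pt; apply/homeo_nbhs.
have [e e0 eP] := oP _ (homeo_eltP t) Pt.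
by exists e => // s ts; apply: eP ts; exact: homeo_eltP.
Qed.

Lemma homeo_dense_dense P : homeo_dense P ->
  dense [set t : homeo_group K | P (set_val t)].
Proof.
move=> dP O [t Ot]; rewrite openE => /(_ _ Ot)/homeo_nbhs[e e0 eO].
have [k [hk Pk tk]] := dP _ _ (homeo_eltP t) e0.
by exists (homeo_elt hk); split=> /=; [apply: eO|]; rewrite set_valE.
Qed.

Definition homeo_lift A : set (K -> K) := [set h | exists2 t, A t & set_val t = h].

Lemma homeo_lift_open A : open A -> homeo_open (homeo_lift A).
Proof.
rewrite openE => oA _ _ [t At <-]; have /homeo_nbhs[e e0 eA] := oA _ At.
by exists e => // k hk tk; exists (homeo_elt hk); [apply: eA|]; rewrite ?set_valE.
Qed.

Lemma homeo_lift_dense A : dense A -> homeo_dense (homeo_lift A).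
Proof.
move=> dA h e hh e0; pose B := [set s : homeo_group K | forall x,
  mdist (h x) ((set_val s : K -> K) x) < e].
have [|s [Bs As]] := dA (B^°) _ (@open_interior _ B).
  exists (homeo_elt hh); apply/homeo_nbhs; by exists e.
exists (set_val s); split; [exact: homeo_eltP|by exists s|].
exact: (interior_subset Bs).
Qed.

End homeo_group_topology.

Section special_homeomorphisms.
Context {R : realType}.
Implicit Types K L : metricType R.

Lemma graph_near K (h k : K -> K) (d : R) :
  0 < d -> (forall x, mdist (h x) (k x) < d) -> near_rel d (graph h) (graph k).
Proof.
move=> d0 hk; split=> _ [x _ <-].
  by exists (x, k x); [exists x|rewrite /= mdistxx].
by exists (x, h x); [exists x|rewrite /= mdistxx].
Qed.

Lemma generic_index_homeo_open K n :
  homeo_open [set h : K -> K | generic_index (graph h) n].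
Proof.
move=> h hh /(generic_index_open (graph_total hh))[d d0 hd].
exists d => // k hk hkd; apply: hd; first exact: graph_total.
exact: graph_near.
Qed.

Lemma generic_index_homeo_dense K n : cantorian K ->
  homeo_dense [set h : K -> K | generic_index (graph h) n].
Proof.
move=> cK h e hh e0; rewrite /generic_index; case: unpickle => [[i j]|] /=.
  by apply: generic_stage_dense; rewrite ?invr_gt0.
by exists h; split=> // x; rewrite mdistxx.
Qed.

Lemma generic_homeo_dense K : cantorian K ->
  homeo_dense [set h : K -> K | generic (graph h)].
Proof.
move=> cK; have [cT _ _ _] := cK.
rewrite (_ : [set h | _] =
    \bigcap_n [set h : K -> K | generic_index (graph h) n]).
  apply: homeo_baire => // n; first exact: generic_index_homeo_open.
  exact: generic_index_homeo_dense.
apply/seteqP; split=> h /= => [/genericP gh n _|gh]; first exact: gh.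
by apply/genericP => n; exact: gh.
Qed.

Lemma conjugate_sym (S T : topologicalType) (f : S -> S) (g : T -> T) :
  conjugate f g -> conjugate g f.
Proof.
move=> [phi [cphi [psi [phiK psiK cpsi]]] gf]; exists psi.
  by split=> //; exists phi.
apply/funext => y /=; apply: (can_inj phiK).
have /= <- := congr1 (@^~ (psi y)) gf.
by rewrite !psiK.
Qed.

Lemma conjugate_generic K L (f : K -> K) (g : L -> L) : compact [set: K] ->
  homeomorphism f -> conjugate f g -> generic (graph f) -> generic (graph g).
Proof.
move=> cK hf [phi hphi gf]; have [psi iphi] := homeomorphism_uniso cK hphi.
apply: (generic_invariant (f := phi) (g := psi)); first exact: graph_total.
  by rewrite !dom_graph.
have [_ phiK _ _] := iphi.
apply/seteqP; split=> [_ [_ [x _ <-] <-]|_ [y _ <-]] /=.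
  by exists (phi x) => //; congr (_, _); exact: (congr1 (@^~ x) gf).
exists (psi y, f (psi y)); first by exists (psi y).
have [_ py] := phiK y I; rewrite /= -[phi (f _)]/((phi \o f) (psi y)) -gf.
by rewrite /= py.
Qed.

Lemma generic_conjugate K L (f : K -> K) (g : L -> L) :
  compact [set: K] -> compact [set: L] -> [set: K] !=set0 -> [set: L] !=set0 ->
  homeomorphism f -> homeomorphism g ->
  generic (graph f) -> generic (graph g) -> conjugate f g.
Proof.
move=> cK cL K0 L0 hf hg gf gg.
have [phi [psi [ipp pfg]]] := generic_uniso (graph_total hf) (graph_total hg)
  (graph_compact cK hf.1) (graph_compact cL hg.1) (graph_nonempty f K0)
  (graph_nonempty g L0) gf gg.
rewrite !dom_graph in ipp; exists phi; first exact: uniso_homeomorphism ipp.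
apply/funext => x /=.
have : graph g (phi x, phi (f x)) by rewrite -pfg; exists (x, f x) => //; exists x.
by move=> [y _ [-> ->]].
Qed.

(** Two dense G_delta sets meet: even indices of [U] list the open sets defining the conjugacy
    class, odd ones the generic stages. A common element is generic and conjugate to [h]. *)
Lemma special_generic K (h : homeo_group K) :
  special_homeomorphism h -> generic (graph (set_val h : K -> K)).
Proof.
move=> [mK dC [F oF CF]]; have cK := cantor_cantorian mK; have [cT _ _ _] := cK.
pose U n := if odd n then [set k : K -> K | generic_index (graph k) n./2]
  else homeo_lift (F n./2).
have [||k [hk Uk _]] :=
    @homeo_baire _ _ cT U _ _ (set_val h : K -> K) 1 (homeo_eltP h) ltr01.
- move=> n; rewrite /U; case: ifP => _; first exact: generic_index_homeo_open.
  exact: homeo_lift_open.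
- move=> n; rewrite /U; case: ifP => _; first exact: generic_index_homeo_dense.
  apply: homeo_lift_dense => O O0 oO; have [t [Ot]] := dC O O0 oO.
  by rewrite CF => /(_ n./2 I) Ft; exists t.
have gk : generic (graph k).
  apply/genericP => n; have := Uk n.*2.+1 I.
  by rewrite /U /= odd_double /= uphalf_double.
have : conjugacy_class h (homeo_elt hk).
  rewrite CF => n _; have := Uk n.*2 I; rewrite /U odd_double doubleK.
  move=> [t Ft tk]; suff -> : homeo_elt hk = t by [].
  by apply: val_inj; rewrite /= -tk set_valE.
move=> /conjugate_sym; rewrite {1}set_valE => hkC.
exact: conjugate_generic gk.
Qed.

(** Conjugacy preserves genericity and generic homeomorphisms are conjugate, so the class of [h] is
    exactly the generic set. *)
Lemma generic_special K (h : homeo_group K) : cantor_metric_space K ->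
  generic (graph (set_val h : K -> K)) -> special_homeomorphism h.
Proof.
move=> mK gh; have cK := cantor_cantorian mK; have [cT K0 _ _] := cK.
have CE : conjugacy_class h =
    [set t : homeo_group K | generic (graph (set_val t : K -> K))].
  apply/seteqP; split=> t /= => [ht|gt].
    exact: (conjugate_generic cT (homeo_eltP h) ht gh).
  by apply: generic_conjugate => //; exact: homeo_eltP.
split=> //.
  by rewrite CE; exact: homeo_dense_dense (generic_homeo_dense cK).
exists (fun n => [set t : homeo_group K |
    generic_index (graph (set_val t : K -> K)) n]).
  move=> n; have := homeo_open_open (@generic_index_homeo_open K n).
  exact.
rewrite CE; apply/seteqP; split=> t /= => [/genericP gt n _|gt]; first exact: gt.
by apply/genericP => n; exact: gt.
Qed.

End special_homeomorphisms.

(** * Cantor sets in perfect Polish spaces *)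

Section cantor_sets.
Context {R : realType}.
Implicit Types V : metricType R.

Definition cantor_set V (N : set V) := [/\ N !=set0, compact N,
  (forall x (e : R), N x -> 0 < e ->
     exists y, [/\ N y, y != x & mdist x y < e]) &
  (forall x y, N x -> N y -> x != y -> exists A B : set V,
     [/\ compact A, compact B, A `&` B = set0, N = A `|` B & A x /\ B y])].

Lemma cantor_setU V (N P : set V) : N `&` P = set0 ->
  cantor_set N -> cantor_set P -> cantor_set (N `|` P).
Proof.
move=> NP [N0 cN pN zN] [P0 cP pP zP]; split.
- by have [x Nx] := N0; exists x; left.
- exact: compactU.
- move=> x e [Nx|Px] e0.
    by have [y [Ny yx xy]] := pN x e Nx e0; exists y; split=> //; left.
  by have [y [Py yx xy]] := pP x e Px e0; exists y; split=> //; right.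
- move=> x y [Nx|Px] [Ny|Py] xy.
  + have [A [B [cA cB AB NAB [Ax By]]]] := zN x y Nx Ny xy.
    exists A, (B `|` P); split=> //; first exact: compactU.
    * rewrite setIUr AB set0U; apply/seteqP; split=> // z [Az Pz].
      by rewrite -NP; split=> //; rewrite NAB; left.
    * by rewrite NAB setUA.
    * by split=> //; left.
  + by exists N, P; split.
  + by exists P, N; split=> //; [rewrite setIC|rewrite setUC].
  + have [A [B [cA cB AB PAB [Ax By]]]] := zP x y Px Py xy.
    exists A, (B `|` N); split=> //; first exact: compactU.
    * rewrite setIUr AB set0U; apply/seteqP; split=> // z [Az Nz].
      by rewrite -NP; split=> //; rewrite PAB; left.
    * by rewrite PAB setUC setUA.
    * by split=> //; left.
Qed.

Lemma perfect_near V x (A : set V) : perfect_set [set: V] -> nbhs x A ->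
  exists2 y, A y & y != x.
Proof.
move=> [_ pV] xA; have : limit_point [set: V] x by rewrite pV.
by move=> /(_ _ xA)[y [yx _ Ay]]; exists y.
Qed.

Section scheme.
Variables (V : metricType R) (d : V -> V -> R).
Hypotheses (dm : is_metric d) (dc : compatible_metric d).
Hypotheses (dcomplete : complete_metric d) (pV : perfect_set [set: V]).

Let d_ge0 x y : 0 <= d x y.
Proof.
have [dxx _ dsym dtri] := dm.
by have := dtri y x x; rewrite dxx (dsym y x); lra.
Qed.

(** Pairs are balls, centre and radius, for the complete metric [d]. A bit keeps the centre [s.1] or
    moves it to [t.1], with radius [t.2] either way. The factor 4 keeps the two new balls apart, and
    displacement plus radius stays below [s.2]. *)
Let child (n : nat) (s t : V * R) :=
  [/\ 0 < t.2, t.2 <= s.2 / 4, t.2 <= n.+1%:R^-1, d s.1 t.1 < s.2 / 2 &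
      4 * t.2 <= d s.1 t.1].

Let child_ex n s : 0 < s.2 -> exists t, child n s t.
Proof.
move=> s0; have [dxx dpos dsym dtri] := dm.
have [|y xy yx] := @perfect_near V s.1 [set z | d s.1 z < s.2 / 2] pV.
  by apply/dc; exists (s.2 / 2); rewrite ?divr_gt0.
have dxy : 0 < d s.1 y.
  rewrite lt_neqAle d_ge0 andbT eq_sym; apply: contra yx => /eqP/dpos ->.
  exact: eqxx.
exists (y, Num.min (s.2 / 4) (Num.min n.+1%:R^-1 (d s.1 y / 4))).
split=> //=.
- by rewrite !lt_min !divr_gt0// invr_gt0 ltr0n.
- by rewrite ge_min lexx.
- by rewrite !ge_min lexx orbT.
- by rewrite mulrC -ler_pdivlMr// !ge_min lexx !orbT.
Qed.

Lemma cantor_scheme (a : V) (e : R) : 0 < e ->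
  exists phi : cantor_space -> V,
    [/\ continuous phi, injective phi & forall z, mdist a (phi z) < e].
Proof.
move=> e0; have [dxx dpos dsym dtri] := dm.
have [r r0 ra] : exists2 r, 0 < r & [set y | d a y < r] `<=` ball a e.
  by apply/dc; exact: nbhsx_ballx.
have [f fP] : {f & forall ns : nat * (V * R), 0 < ns.2.2 ->
    child ns.1 ns.2 (f ns)}.
  apply: (@boolp.choice _ _ (fun ns t => 0 < ns.2.2 -> child ns.1 ns.2 t)) => -[n s] /=.
  have [s0|ns] := pselect (0 < s.2); last by exists s.
  by have [t st] := child_ex n s0; exists t.
pose st (z : cantor_space) := fix st n := if n is m.+1 then
   ((if z m then (f (m, st m)).1 else (st m).1), (f (m, st m)).2)
   else (a, r / 2).
pose c z n := (st z n).1; pose rho z n := (st z n).2.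
have rho0 z n : 0 < rho z n.
  elim: n => [|n IH]; first by rewrite /rho/= divr_gt0.
  by have [] := fP (n, st z n) IH.
have childP z n := fP (n, st z n) (rho0 z n).
have rhoS z n : rho z n.+1 <= rho z n / 4 by have [] := childP z n.
have rho_small z n : rho z n.+1 <= n.+1%:R^-1 by have [] := childP z n.
have cS z n : d (c z n) (c z n.+1) < rho z n / 2.
  rewrite /c /=; case: (z n); first by have [] := childP z n.
  by rewrite dxx divr_gt0.
have cnm z n m : (n <= m)%N -> d (c z n) (c z m) <= rho z n - rho z m.
  elim: m => [|m IH]; first by rewrite leqn0 => /eqP ->; rewrite dxx subrr.
  rewrite leq_eqVlt; case/predU1P=> [->|/IH nm]; first by rewrite dxx subrr.
  have := dtri (c z m) (c z n) (c z m.+1).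
  have := cS z m; have := rhoS z m; have := rho0 z m; lra.
have small z (b : R) : 0 < b -> exists n, rho z n.+1 < b.
  by move=> /exists_natSinv[n nb]; exists n; exact: le_lt_trans nb.
have lim_ex z : exists l : V, c z @ \oo --> l.
  apply: dcomplete => b b0; have b20 : 0 < b / 2 by rewrite divr_gt0.
  have [n nb] := small z _ b20; exists n.+1 => m k nm nk.
  have := dtri (c z n.+1) (c z m) (c z k); rewrite (dsym (c z m) (c z n.+1)).
  have := cnm z _ _ nm; have := cnm z _ _ nk.
  have := rho0 z m; have := rho0 z k; lra.
have [phi phiP] := boolp.choice lim_ex.
have cphi z n : d (c z n) (phi z) <= rho z n.
  apply/ler_addgt0Pl => b b0.
  have : nbhs (phi z) [set y | d (phi z) y < b] by apply/dc; exists b.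
  move=> /(phiP z)[m _ mb].
  have := mb (maxn m n) (leq_maxl _ _); have := cnm z n _ (leq_maxr m n).
  have := dtri (c z (maxn m n)) (c z n) (phi z); rewrite /= (dsym (phi z)).
  have := rho0 z (maxn m n); lra.
have st_prefix z z' n : (forall i, (i < n)%N -> z i = z' i) -> st z n = st z' n.
  elim: n => // n IH zz'; rewrite /= IH => [|i ni]; last exact/zz'/ltnW.
  by rewrite zz'.
exists phi; split.
- move=> z A /dc[b b0 bA].
  have b20 : 0 < b / 2 by rewrite divr_gt0.
  have [n nb] := small z _ b20.
  have : nbhs z [set w : cantor_space | forall i, (i < n.+1)%N -> z i = w i].
    elim: (n.+1) => [|k IH]; first exact: filterS filterT.
    have : nbhs z [set w : cantor_space | z k = w k].
      have pc : {for z, continuous (proj k : cantor_space -> bool)}.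
        exact: proj_continuous.
      by apply: (pc [set b | z k = b]); rewrite /nbhs/= /principal_filter.
    move=> nk; apply: filterS (filterI IH nk) => w [wk1 wk2] i.
    rewrite ltnS leq_eqVlt; case/predU1P=> [->//|]; exact: wk1.
  apply: filterS => w /st_prefix zw; apply: bA => /=.
  have := cphi z n.+1; have := cphi w n.+1; rewrite /c /rho -zw.
  have := dtri (st z n.+1).1 (phi z) (phi w).
  rewrite (dsym (phi z) (st z n.+1).1).
  move: nb; rewrite /rho; lra.
- move=> z w zw; apply: contrapT => nzw.
  have ex : exists n, z n != w n.
    apply: contrapT => nn; apply: nzw; apply/funext => n; apply/eqP.
    by apply: contrapT => zn; apply: nn; exists n; exact/negP.
  (* Up to the first differing bit the balls agree; afterwards the limits lie within one radius of
     centres at least four radii apart. *)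
  case: (ex_minnP ex) => n zn minn.
  have pre : st z n = st w n.
    apply: st_prefix => i ni; apply/eqP; apply: contraTT ni => zi.
    by rewrite -leqNgt; exact: minn.
  have := cphi z n.+1; have := cphi w n.+1; rewrite -zw /c /rho /= -pre.
  have [+ _ _ _ +] := childP z n; rewrite /=.
  have := dtri (phi z) (st z n).1 (f (n, st z n)).1.
  have := dtri (phi z) (f (n, st z n)).1 (st z n).1.
  rewrite !(dsym (phi z)) (dsym (f (n, st z n)).1 (st z n).1).
  by move: zn; case: (z n) (w n) => -[] //= _; lra.
- move=> z; suff : ball a e (phi z) by rewrite ballEmdist.
  apply: ra => /=; have := cphi z 0%N; rewrite /c /rho /=; lra.
Qed.

End scheme.

Lemma cantor_subset V (a : V) (e : R) :
  polish R V -> perfect_set [set: V] -> 0 < e ->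
  exists2 C : set V, cantor_set C & forall x, C x -> mdist a x < e.
Proof.
move=> [_ [d [dm dc dcomp]]] pV e0.
have [phi [cphi iphi ae]] := cantor_scheme dm dc dcomp pV a e0.
have comp (A : set cantor_space) : closed A -> compact (phi @` A).
  move=> cA; apply: continuous_compact; first exact: continuous_subspaceT.
  exact: subclosed_compact cantor_space_compact _.
exists (range phi); last by move=> _ [z _ <-].
split.
- by exists (phi point); exists point.
- by apply: comp; exact: closedT.
- move=> _ b [z _ <-] b0; have [_ pC] := cantor_perfect.
  have : limit_point [set: cantor_space] z by rewrite pC.
  move=> /(_ _ (cphi z _ (nbhsx_ballx _ b b0)))[w [wz _ zw]].
  exists (phi w); split; first by exists w.
    by apply: contra wz => /eqP/iphi ->.
  by move: zw; rewrite /= ballEmdist.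
- move=> _ _ [z _ <-] [w _ <-] zw.
  have [|U [[oU cU] Uz Uw]] := @cantor_zero_dimensional z w.
    by apply: contra zw => /eqP ->.
  exists (phi @` U), (phi @` (~` U)); split.
  + exact: comp.
  + by apply: comp; exact: open_closedC.
  + by apply/seteqP; split=> // _ [[x Ux <-] [y Uy /iphi yx]]; rewrite yx in Uy.
  + by rewrite -image_setU setUCr.
  + by split; [exists z|exists w].
Qed.

(** Cantor sets within [r] of the points of [s] are disjoint by the separation [2 * r], and their
    finite union is again a Cantor set. *)
Lemma cantor_set_near V (s : seq V) (r : R) :
  polish R V -> perfect_set [set: V] -> 0 < r -> s != [::] ->
  (forall a b, a \in s -> b \in s -> a != b -> 2 * r <= mdist a b) ->
  exists2 N : set V, cantor_set N &
    (forall x, N x -> exists2 a, a \in s & mdist a x < r) /\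
    (forall a, a \in s -> exists2 x, N x & mdist a x < r).
Proof.
move=> plV pV r0; elim: s => // a s IH _ sep.
have [C cC Ca] := cantor_subset a plV pV r0.
have [C0 _ _ _] := cC.
have [as_|nas] := boolP (a \in s).
  have [||N cN [Ns sN]] := IH; first by case: (s) as_.
    by move=> x y xs ys; apply: sep; rewrite inE ?xs ?ys orbT.
  exists N => //; split=> [x /Ns[b bs bx]|b]; first by exists b; rewrite // inE bs orbT.
  by rewrite inE; case/predU1P=> [->|]; exact: sN.
have [s0|s0] := eqVneq s [::].
  exists C => //; split=> [x /Ca ax|b]; first by exists a; rewrite // mem_head.
  rewrite s0 inE => /eqP ->; have [x Cx] := C0; exists x => //; exact: Ca.
have [||N cN [Ns sN]] := IH => //.
  by move=> x y xs ys; apply: sep; rewrite inE ?xs ?ys orbT.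
exists (C `|` N).
  apply: cantor_setU => //; apply/seteqP; split=> // x [/Ca ax /Ns[b bs bx]].
  have ab : a != b by apply: contraNneq nas => ->.
  have := sep a b (mem_head _ _) _ ab; rewrite inE bs orbT => /(_ isT).
  by have := metric_triangle a x b; rewrite (metric_sym x b); lra.
split=> [x [/Ca ax|/Ns[b bs bx]]|b].
- by exists a; rewrite // mem_head.
- by exists b; rewrite // inE bs orbT.
rewrite inE; case/predU1P=> [->|/sN[x Nx bx]]; last by exists x => //; right.
by have [x Cx] := C0; exists x; [left|exact: Ca].
Qed.

Lemma subtype_compact V (N : set V) : compact N -> compact [set: N].
Proof.
move=> cN F PF _; have [|p [Np Fp]] := cN (set_val @ F).
  by apply: (@filterS _ F _ [set: N]); [move=> x _; exact: set_valP|exact: filterT].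
exists (exist _ p (mem_set Np)); split=> // A B FA /nbhs_ballP[e /= e0 eB].
have [_ [[a Aa <-] pa]] := Fp (set_val @` A) (ball p e)
  (filterS (@preimage_image _ _ _ _) FA) (nbhsx_ballx _ _ e0).
by exists a; split=> //; apply: eB.
Qed.

Lemma cantor_set_cantorian V (N : set V) : cantor_set N ->
  cantorian (set_type N : metricType R).
Proof.
move=> [N0 cN pN zN]; have cNT := subtype_compact cN; split=> //.
- by have [x Nx] := N0; exists (exist _ x (mem_set Nx)).
- move=> x e e0; have [y [Ny yx xy]] := pN _ e (set_valP x) e0.
  by exists (exist _ y (mem_set Ny)).
move=> e; apply: totally_disconnected_fine => //.
apply: zero_dimension_totally_disconnected => x y xy.
have [|A [B [cA cB AB NAB [Ax By]]]] := zN _ _ (set_valP x) (set_valP y).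
  by apply: contra xy => /eqP/val_inj ->.
have vc : continuous (set_val : N -> V) by exact: initial_continuous.
have clos (C : set V) : compact C -> closed (set_val @^-1` C : set N).
  move=> cC; apply: closed_comp; first by move=> z _; exact: vc.
  by apply: compact_closed cC; exact: metric_hausdorff.
exists (set_val @^-1` A); split=> //; last first.
  by move=> Ay; have : (A `&` B) (set_val y) by []; rewrite AB.
split; last exact: clos.
rewrite -[X in open X]setCK openC (_ : ~` _ = set_val @^-1` B); first exact: clos.
apply/seteqP; split=> z /= => [nA|Bz Az].
  by have : (A `|` B) (set_val z) by [rewrite -NAB; exact: set_valP]; case.
by have : (A `&` B) (set_val z) by []; rewrite AB.
Qed.

Lemma cantorian_cantor (K : metricType R) : cantorian K -> cantor_metric_space K.
Proof.
move=> [cK K0 pK fK]; split=> //.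
- split; first exact: closedT.
  apply/seteqP; split=> // x _ A /nbhs_ballP[e /= e0 eA].
  have [y yx xy] := pK x e e0; exists y; split=> //.
  by apply: eA; rewrite ballEmdist.
apply: zero_dimension_totally_disconnected => x y xy.
have [|T [k [[d d0 kd] kf]]] := fK (mdist x y); first by rewrite mdist_gt0.
have op (t : T) : open [set z | k z = t].
  rewrite openE => z kz; apply/nbhs_ballP; exists d => // w.
  by rewrite ballEmdist => zw; rewrite /= -kz; apply/esym/kd.
exists [set z | k z = k x]; split=> //; last first.
  by move=> /= kyx; have := fine_lt kf I I (esym kyx); rewrite ltxx.
split=> //; rewrite -openC (_ : ~` _ = \bigcup_(t in [set t | t <> k x]) [set z | k z = t]).
  by apply: bigcup_open => t _; exact: op.
apply/seteqP; split=> z /= => [kz|[t tx kzt] kzx]; first by exists (k z).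
by apply: tx; rewrite -kzx -kzt.
Qed.

Lemma uniso_cantorian (K L : metricType R) (f : K -> L) g :
  cantorian K -> compact [set: L] -> uniso [set: K] [set: L] f g -> cantorian L.
Proof.
move=> [cK K0 pK fK] cL [fg gf uf ug]; split=> //.
- by have [x _] := K0; exists (f x).
- move=> y e e0; have [d d0 fd] := uf e e0; have [x xy yx] := pK (g y) d d0.
  have [_ fgy] := gf y I; exists (f x); last by rewrite -[y]fgy; exact: fd.
  by apply: contra xy => /eqP <-; have [_ ->] := fg x I.
move=> e e0; have e20 : 0 < e / 2 by rewrite divr_gt0.
have [d d0 fd] := uf _ e20; have [T [k [[r r0 kr] kf]]] := fK d d0.
exists T, (k \o g); split.
  have [b b0 gb] := ug _ r0; exists b => // x y _ _ xy; apply: kr => //.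
  exact: gb.
exists (e / 2); first by lra.
move=> x y _ _ kxy; have [_ <-] := gf x I; have [_ <-] := gf y I.
by apply/ltW/fd => //; exact: fine_lt kf _ _ kxy.
Qed.

End cantor_sets.

(** * The space DS(V) *)

Section generic_systems.
Context {R : realType}.
Implicit Types V : metricType R.

Lemma set_ballP V (X : set (V * V)) (e : R) (p : V * V) : set_ball X e p <->
  exists2 q, X q & mdist q.1 p.1 < e /\ mdist q.2 p.2 < e.
Proof.
split=> [[q Xq]|[q Xq [q1 q2]]]; last first.
  by exists q => //; rewrite ballEmdist /= /mdist/= /prod_mdist gt_max q1.
rewrite ballEmdist /= /mdist/= /prod_mdist gt_max => /andP[q1 q2].
by exists q.
Qed.

Lemma mdist_near V (f g : hyperspace (V * V)%type) (d : R) :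
  mdist f g < d -> near_rel d f g.
Proof.
move=> fg.
pose E (f g : hyperspace (V * V)%type) :=
  [set e : R | [/\ 0 < e, f `<=` set_ball g e & g `<=` set_ball f e]].
have [e [e0 fge gfe] ed] : exists2 e, E f g e & e < d.
  (* The infimum of the empty set is 0; if [E f g] were empty, [f] and [g] would coincide, and then
     1 would belong to it. *)
  apply: inf_lt => //; apply/set0P/negP => /eqP E0.
  have fg0 : f = g by apply: mdist_positivity; rewrite /mdist/= /hausdorff_dist -/(E f g) E0 inf0.
  suff : E f g 1 by rewrite E0.
  by split=> //; rewrite fg0 => x gx; exists x => //; exact: ballxx.
split=> [p /fge/set_ballP[q gq [q1 q2]]|p /gfe/set_ballP[q fq [q1 q2]]].
  exists q => //; rewrite (metric_sym p.1) (metric_sym p.2).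
  by rewrite (lt_trans q1)// (lt_trans q2).
by exists q => //; rewrite (lt_trans q1)// (lt_trans q2).
Qed.

Lemma near_mdist V (f g : hyperspace (V * V)%type) (d : R) :
  0 < d -> near_rel d f g -> mdist f g <= d.
Proof.
move=> d0 [fg gf]; apply: ge_inf; first by exists 0 => e [/ltW].
split=> // p; last by move=> /gf[q fq qp]; apply/set_ballP; exists q.
move=> /fg[q gq [q1 q2]]; apply/set_ballP; exists q => //.
by rewrite (metric_sym q.1) (metric_sym q.2).
Qed.

Section DS_facts.
Variables (V : metricType R) (f : DS V).

Lemma DS_total : total_rel (DS_graph f).
Proof. by have := set_valP f. Qed.

Lemma DS_compact : compact (DS_graph f).
Proof. exact: hyperspace_compact. Qed.

Lemma DS_nonempty : DS_graph f !=set0.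
Proof. exact: hyperspace_nonempty. Qed.

End DS_facts.

Lemma subtype_uniso V (N : set V) : N !=set0 ->
  exists g : V -> N, uniso [set: N] N set_val g.
Proof.
move=> [x0 Nx0].
have [g gP] : {g : V -> N & forall x, N x -> set_val (g x) = x}.
  apply: (@boolp.choice _ _ (fun x y => N x -> set_val y = x)) => x.
  have [Nx|] := pselect (N x); first by exists (exist _ x (mem_set Nx)).
  by exists (exist _ x0 (mem_set Nx0)).
exists g; split.
- move=> x _; have Nx := set_valP x; split=> //.
  by apply: val_inj; exact: gP.
- by move=> x Nx; split=> //; exact: gP.
- by move=> e e0; exists e.
- move=> e e0; exists e => // x y Nx Ny xy.
  by rewrite -[mdist _ _]/(mdist (set_val (g x)) (set_val (g y))) !gP.
Qed.

Lemma DS_support_nonempty V (f : DS V) : DS_support f !=set0.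
Proof. by have [z fz] := DS_nonempty f; exists z.1, z. Qed.

Lemma DS_SH_generic V (f : DS V) : DS_SH V f -> generic (DS_graph f).
Proof.
move=> [_ [g [gf hg [K [h [sh gh]]]]]].
have cK : compact [set: K] by case: sh => -[].
have gg : generic (graph g).
  apply: (conjugate_generic cK (homeo_eltP h) _ (special_generic sh)).
  exact: conjugate_sym.
have [psi ip] := subtype_uniso (DS_support_nonempty f).
apply: generic_invariant gg; first exact: graph_total.
  by rewrite dom_graph; exact: ip.
by rewrite gf /img /graph image_comp.
Qed.

Lemma homeomorphism_inverse (S T : topologicalType) (f : S -> T) g :
  cancel f g -> cancel g f -> continuous f -> continuous g -> homeomorphism f.
Proof. by move=> *; split=> //; exists g. Qed.

(** Some Cantor set in [V] carries a generic homeomorphism. By uniqueness its graph is isomorphic to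
    [f], which thereby inherits a Cantor support and the property of being the graph of a
    homeomorphism. *)
Lemma generic_DS_SH V (f : DS V) : polish R V -> perfect_set [set: V] ->
  generic (DS_graph f) -> DS_SH V f.
Proof.
move=> plV pV gf.
have [p0 _] := DS_support_nonempty f.
have [C cC _] := cantor_subset p0 plV pV ltr01.
pose K : metricType R := set_type C.
have caK : cantorian K := cantor_set_cantorian cC.
have [cK K0 _ _] := caK.
have hid : homeomorphism (id : K -> K).
  by apply: (@homeomorphism_inverse _ _ id id) => // x; exact: cvg_id.
have [h [hh gh _]] := generic_homeo_dense caK hid ltr01.
have sh : special_homeomorphism (homeo_elt hh).
  apply: generic_special; first exact: cantorian_cantor.
  by rewrite set_valE.
have [a [b [iab af]]] := generic_uniso (graph_total hh) (DS_total f)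
  (graph_compact cK hh.1) (@DS_compact _ f) (graph_nonempty h K0) (DS_nonempty f)
  gh gf.
rewrite dom_graph in iab; have [ab ba ua ub] := iab.
pose N : metricType R := set_type (DS_support f).
pose phi (x : K) : N := exist _ (a x) (mem_set (ab x I).1).
pose psi (y : N) : K := b (set_val y).
have psiphi x : psi (phi x) = x by rewrite /psi /phi set_valE; exact: (ab x I).2.
have phipsi y : phi (psi y) = y.
  by apply: val_inj; exact: (ba _ (set_valP y)).2.
have iphi : uniso [set: K] [set: N] phi psi.
  split=> //.
  move=> e /ub[d d0 bd]; exists d => // x y _ _ xy.
  by apply: bd => //; exact: set_valP.
have cN : compact [set: N].
  exact: subtype_compact (compact_dom (@DS_compact _ f)).
have hphi := uniso_homeomorphism iphi.
have cpsi : continuous psi by apply: unif_continuous; case: iphi.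
pose g : N -> N := phi \o h \o psi.
split; first exact: cantorian_cantor (uniso_cantorian caK cN iphi).
have [ch [k [hk kh ck]]] := hh; have [cphi _] := hphi.
exists g; split.
- rewrite /is_graph_of -af; apply/seteqP; split=> [_ [_ [x _ <-] <-]|_ [y _ <-]].
    exists (phi x) => //; congr (_, _).
    by rewrite /g /= psiphi.
  exists (psi y, h (psi y)); first by exists (psi y).
  by congr (_, _); rewrite /=; exact: (ba _ (set_valP y)).2.
- apply: (@homeomorphism_inverse _ _ g (phi \o k \o psi)).
  + by move=> y; rewrite /g /= psiphi hk phipsi.
  + by move=> y; rewrite /g /= psiphi kh phipsi.
  + move=> y; apply: continuous_comp; first exact: cpsi.
    by apply: continuous_comp; [exact: ch|exact: cphi].
  + move=> y; apply: continuous_comp; first exact: cpsi.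
    by apply: continuous_comp; [exact: ck|exact: cphi].
- exists K, (homeo_elt hh); split=> //; apply: conjugate_sym.
  exists phi => //; apply/funext => x; rewrite /g /= psiphi.
  by rewrite set_valE.
Qed.

Lemma DS_SH_Gdelta V : polish R V -> perfect_set [set: V] -> Gdelta (DS_SH V).
Proof.
move=> plV pV.
exists (fun n => [set f : DS V | generic_index (DS_graph f) n]).
  move=> n; rewrite openE => f /(generic_index_open (DS_total f))[d d0 fd].
  apply/nbhs_ballP; exists d => // g; rewrite ballEmdist /= => fg.
  by apply: fd (DS_total g) _; exact: mdist_near.
apply/seteqP; split=> f /= => [/DS_SH_generic/genericP gf n _|gf]; first exact: gf.
by apply: generic_DS_SH => //; apply/genericP => n; exact: gf.
Qed.

Lemma seq_lower_bound (s : seq R) : (forall x, x \in s -> 0 < x) ->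
  exists2 r, 0 < r & forall x, x \in s -> r <= x.
Proof.
elim: s => [|x s IH] xs; first by exists 1.
have [|r r0 rs] := IH; first by move=> y ys; apply: xs; rewrite inE ys orbT.
exists (Num.min r x); first by rewrite lt_min r0 xs// mem_head.
by move=> y; rewrite inE ge_min; case/predU1P=> [->|/rs ->//]; rewrite lexx orbT.
Qed.

Lemma seq_separated V (s : seq V) : exists2 r : R, 0 < r &
  forall a b, a \in s -> b \in s -> a != b -> r <= mdist a b.
Proof.
pose l := [seq mdist p.1 p.2 | p <- [seq p <- [seq (a, b) | a <- s, b <- s] |
  p.1 != p.2]].
have [|r r0 rl] := @seq_lower_bound l.
  move=> x /mapP[p]; rewrite mem_filter => /andP[pp _] ->.
  by rewrite mdist_gt0.
exists r => // a b as_ bs ab; apply: rl; apply/mapP; exists (a, b) => //.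
by rewrite mem_filter ab; apply/allpairsP; exists (a, b).
Qed.

Lemma continuous_pair (S T U : topologicalType) (f : S -> T) (g : S -> U) :
  continuous f -> continuous g -> continuous (fun x => (f x, g x)).
Proof.
by move=> cf cg x; apply: cvg_pair => //; [exact: cf|exact: cg].
Qed.

Lemma generic_DS_dense V (f : DS V) (e : R) :
  polish R V -> perfect_set [set: V] -> 0 < e ->
  exists2 g : DS V, generic (DS_graph g) & mdist f g < e.
Proof.
move=> plV pV e0; pose F := DS_graph f.
have [Ft cF F0] := And3 (DS_total f) (@DS_compact _ f) (DS_nonempty f).
have e40 : 0 < e / 4 by rewrite divr_gt0.
have [s' [s'M Ms']] := finite_net (compact_dom cF) e40.
pose s := undup s'.
have sM p : p \in s -> dom F p by rewrite mem_undup; exact: s'M.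
have Ms x : dom F x -> exists2 p, p \in s & mdist p x < e / 4.
  by move=> /Ms'[p ps px]; exists p; rewrite ?mem_undup.
have us : uniq s := undup_uniq s'.
have s0 : s != [::].
  have [z Fz] := F0; have [|p] := Ms z.1; first by exists z.
  by case: (s).
have [q q0 sq] := seq_separated s.
(* Net points are [3 * r] apart, so points of [N] closer than [r] belong to the same net point and
   [c] is a colouring; [e / 4 + r <= e / 2] is the final error. *)
pose r := Num.min (q / 3) (e / 4).
have r0 : 0 < r by rewrite lt_min !divr_gt0.
have re : r <= e / 4 by rewrite ge_min lexx orbT.
have sep a b : a \in s -> b \in s -> a != b -> 3 * r <= mdist a b.
  move=> as_ bs ab; apply: le_trans (sq _ _ as_ bs ab).
  by rewrite mulrC -ler_pdivlMr// ge_min lexx.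
have [|N cN [Ns sN]] := cantor_set_near plV pV r0 s0.
  by move=> a b as_ bs ab; have := sep _ _ as_ bs ab; lra.
pose K : metricType R := set_type N.
have caK : cantorian K := cantor_set_cantorian cN.
have [cK K0 _ _] := caK.
pose J := 'I_(size s); pose v (i : J) := tnth (in_tuple s) i.
have vs i : v i \in s by exact: mem_tnth.
have sv a : a \in s -> exists i, v i = a.
  by move=> /(tnthP (in_tuple s))[i ->]; exists i.
have vinj : injective v by move=> i j; move/(tuple_uniqP (in_tuple s)): us; exact.
have [c cP] : {c : K -> J & forall x, mdist (v (c x)) (set_val x) < r}.
  apply: (@boolp.choice _ _ (fun x i => mdist (v i) (set_val x) < r)) => x.
  by have [a /sv[i <-] ax] := Ns _ (set_valP x); exists i.
have cU i y : mdist (v i) (set_val y) < 2 * r -> c y = i.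
  move=> iy; apply: vinj; apply/eqP; apply: contraT => ij.
  have := sep _ _ (vs _) (vs _) ij; have := cP y.
  have := metric_triangle (v (c y)) (set_val y) (v i).
  rewrite (metric_sym (set_val y)); lra.
have cr x y : mdist x y < r -> c x = c y.
  move=> xy; apply/esym/cU; have := cP x.
  have := metric_triangle (v (c x)) (set_val x) (set_val y).
  by rewrite -[mdist (set_val x) (set_val y)]/(mdist x y); lra.
have cc : colouring [set: K] c by exists r => // x y _ _; exact: cr.
pose E : set (J * J) := [set ij | exists2 p, F p &
  mdist (v ij.1) p.1 < e / 4 /\ mdist (v ij.2) p.2 < e / 4].
have Fv x : dom F x -> exists i, mdist (v i) x < e / 4.
  by move=> /Ms[p /sv[i <-] px]; exists i.
have Fsnd p : F p -> dom F p.2 by move=> Fp; rewrite Ft; exists p.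
have Et : total_rel E.
  apply/total_relP; split=> i j [p Fp [ip jp]].
    have [p' Fp' pp'] := Fsnd _ Fp; have [k kp] := Fv _ (Fsnd _ Fp').
    by exists k, p' => //; rewrite pp'.
  have : (snd @` F) p.1 by rewrite -Ft; exists p.
  move=> [p' Fp' pp']; have [|k kp] := Fv p'.1; first by exists p'.
  by exists k, p' => //; rewrite pp'.
have cE : c @` [set: K] = dom E.
  apply/seteqP; split=> i _.
    have [p Fp pi] := sM _ (vs i); have [j jp] := Fv _ (Fsnd _ Fp).
    by exists (i, j) => //; exists p => //=; rewrite pi mdistxx.
  have [x Nx ix] := sN _ (vs i); exists (exist _ x (mem_set Nx)) => //.
  by apply: cU; rewrite set_valE /=; lra.
have [h1 hh1 h1E] := realize_colouring caK cc Et cE.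
(* Moving [h1] by less than [r] leaves its transition graph unchanged, since [c] ignores such
   displacements. *)
have [h [hh gh h1h]] := generic_homeo_dense caK hh1 r0.
have hE : img c (graph h) = E.
  rewrite -h1E /img /graph !image_comp; apply: eq_imagel => x _ /=.
  by congr (_, _); apply/esym/cr.
pose G : set (V * V) := img set_val (graph h).
have vc : continuous (set_val : N -> V) by exact: initial_continuous.
have cG : compact G.
  rewrite /G /img /graph image_comp; apply: continuous_compact cK.
  apply: continuous_subspaceT.
  apply: (@continuous_pair K V V set_val (set_val \o h)) => // x.
  by apply: (@continuous_comp _ _ _ h set_val); [exact: hh.1|exact: vc].
have G0 : G !=set0.
  by have [x _] := K0; exists (set_val x, set_val (h x)); exists (x, h x) => //; exists x.
have Gt : total_rel G by apply/img_total/graph_total.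
have GDS : DS V (Hyperspace cG G0) by [].
exists (exist _ (Hyperspace cG G0) (mem_set GDS)).
  have N0 : N !=set0 by case: cN.
  have [psi ip] := subtype_uniso N0.
  have NG : dom G = N.
    rewrite img_fst dom_graph; apply/seteqP; split=> [_ [x _ <-]|x Nx].
      exact: set_valP.
    by exists (exist _ x (mem_set Nx)).
  apply: (generic_invariant (f := set_val) (g := psi)) gh; first exact: graph_total.
    by rewrite dom_graph /DS_graph set_valE /= NG.
  by rewrite /DS_graph set_valE.
have e20 : 0 < e / 2 by rewrite divr_gt0.
apply: (@le_lt_trans _ _ (e / 2)); last by lra.
apply: near_mdist => //; split.
  move=> p Fp; have [|i ip] := Fv p.1; first by exists p.
  have [j jp] := Fv _ (Fsnd _ Fp).
  have : E (i, j) by exists p.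
  rewrite -hE => -[_ [x _ <-] [cx chx]].
  exists (set_val x, set_val (h x)); first by exists (x, h x) => //; exists x.
  have := cP x; have := cP (h x); rewrite /= cx chx.
  have := metric_triangle p.1 (v i) (set_val x).
  have := metric_triangle p.2 (v j) (set_val (h x)).
  by rewrite (metric_sym p.1 (v i)) (metric_sym p.2 (v j)); lra.
move=> _ [_ [x _ <-] <-]; have : E (c x, c (h x)).
  by rewrite -hE; exists (x, h x) => //; exists x.
move=> [p Fp [/= ip jp]]; exists p => //=; have := cP x; have := cP (h x).
have := metric_triangle p.1 (v (c x)) (set_val x).
have := metric_triangle p.2 (v (c (h x))) (set_val (h x)).
by rewrite (metric_sym p.1 (v _)) (metric_sym p.2 (v _)); lra.
Qed.

End generic_systems.

Theorem theorem2p20 (R : realType) (V : metricType R)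
    (polishV : polish R V) (perfectV : perfect_set [set: V]%classic) :
  dense (DS_SH V) /\ Gdelta (DS_SH V).
Proof.
split; last exact: DS_SH_Gdelta.
move=> O [f Of]; rewrite openE => /(_ _ Of)/nbhs_ballP[e /= e0 eO].
have [g gg fg] := generic_DS_dense f polishV perfectV e0.
exists g; split; first by apply: eO; rewrite ballEmdist.
exact: generic_DS_SH.
Qed.
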